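(* Let $G$ be a residually finite group and $H$ be a subgroup of $G$. Let $\alpha:G\to\mathrm{Aut}(A)$ be an action of $G$ on a C*-algebra $A$ and $\alpha_H:H\to\mathrm{Aut}(A)$ be the restricted action of $H$ on $A$. If $H$ is a virtual retract of $G$, then $\dim_{\mathrm{Rok}}(\alpha_H)\leq\dim_{\mathrm{Rok}}(\alpha)$ and $\dim^c_{\mathrm{Rok}}(\alpha_H)\leq\dim^c_{\mathrm{Rok}}(\alpha)$.
   Context: All groups are countable and discrete. A subgroup $H$ of a group $K$ is a retract of $K$ if there is a group homomorphism $\rho:K\to H$ restricting to the identity on $H$. A subgroup $H$ of $G$ is a virtual retract of $G$ if there is a finite index subgroup $K$ of $G$ such that $H$ is a retract of $K$ (in particular $H\subset K$). Elements $a,b$ of a C*-algebra are orthogonal, $a\perp b$, if $ab=ba=a^*b=b^*a=0$. A contractive completely positive (c.c.p.) map has order zero if it sends orthogonal elements to orthogonal elements. Central sequence algebra: $A_\infty:=\ell^\infty(\mathbb{N},A)/c_0(\mathbb{N},A)$, with $A$ embedded as constant sequences. For a C*-subalgebra $D\subset A$, $A_\infty\cap D'=\{x\in A_\infty: xd=dx\ \forall d\in D\}$, $\mathrm{Ann}(D,A_\infty)=\{x\in A_\infty: xd=dx=0\ \forall d\in D\}$, and $F(D,A):=(A_\infty\cap D')/\mathrm{Ann}(D,A_\infty)$, which is unital if $D$ is $\sigma$-unital. If $D$ is invariant under an action $\alpha$ of $G$ on $A$, $\widetilde{\alpha}_\infty$ denotes the induced action of $G$ on $F(D,A)$. Rokhlin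 dimension of an action $\alpha:G\to\mathrm{Aut}(A)$ of a residually finite group $G$: for a subgroup $L\leq G$ of finite index, $\sigma^L$ is the action of $G$ on $C(G/L)$ given by $\sigma^L_t(f)(gL)=f(t^{-1}gL)$. $\dim_{\mathrm{Rok}}(\alpha,L)$ is the least integer $d\ge 0$ such that for every separable $\alpha$-invariant C*-subalgebra $D\subset A$ there exist $(d+1)$ $G$-equivariant c.c.p. order zero maps $\varphi_0,\ldots,\varphi_d:(C(G/L),\sigma^L)\to(F(D,A),\widetilde{\alpha}_\infty)$ with $\sum_{\ell=0}^d\varphi_\ell(1_{C(G/L)})=1_{F(D,A)}$ (and $+\infty$ if no such $d$ exists). $\dim^c_{\mathrm{Rok}}(\alpha,L)$ (commuting towers) is defined in the same way, requiring in addition that $\varphi_0,\ldots,\varphi_d$ have pairwise commuting ranges. $\dim_{\mathrm{Rok}}(\alpha)=\sup_L\dim_{\mathrm{Rok}}(\alpha,L)$ and $\dim^c_{\mathrm{Rok}}(\alpha)=\sup_L\dim^c_{\mathrm{Rok}}(\alpha,L)$, the suprema over all finite index subgroups $L$ of $G$. The same definitions apply to $\alpha_H$ with $H$ in place of $G$. *)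

(* Defs.v *)
From HB Require Import structures.
From mathcomp Require Import all_boot all_order all_algebra.
From mathcomp Require Import all_classical all_reals all_analysis.
From mathcomp Require Import complex ring lra.

Set Implicit Arguments.
Unset Strict Implicit.
Unset Printing Implicit Defensive.

Import Order.TTheory GRing.Theory Num.Theory.
Import numFieldNormedType.Exports.

Local Open Scope classical_set_scope.
Local Open Scope complex_scope.
Local Open Scope ring_scope.

(* On modules over R[i] the library norm `|x| is R[i]-valued; nrm is the same
   number seen in R, so that sup and inf are available. *)
Definition nrm (R : realType) (V : normedZmodType R[i]) (x : V) : R :=
  complex.Re `|x|.

Section NrmTheory.
Variables (R : realType) (V : normedZmodType R[i]).
Implicit Types x y : V.

Lemma nrmE x : `|x| = (nrm x)%:C.
Proof. by rewrite /nrm RRe_real ?ger0_real. Qed.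

Lemma nrm_ge0 x : 0 <= nrm x.
Proof. by rewrite -ler0c -nrmE. Qed.

Lemma nrm0 : nrm (0 : V) = 0.
Proof. by rewrite /nrm normr0. Qed.

Lemma nrm_eq0 x : nrm x = 0 -> x = 0.
Proof. by move=> x0; apply/normr0_eq0; rewrite nrmE x0. Qed.

Lemma nrmD x y : nrm (x + y) <= nrm x + nrm y.
Proof. by rewrite -lecR rmorphD /= -!nrmE ler_normD. Qed.

Lemma nrmN x : nrm (- x) = nrm x.
Proof. by rewrite /nrm normrN. Qed.

Lemma nrmB x y : nrm (x - y) = nrm (y - x).
Proof. by rewrite -nrmN opprB. Qed.

End NrmTheory.

Lemma nrmM (R : realType) (c d : R[i]) : nrm (c * d) = nrm c * nrm d.
Proof. by apply: (@complexI R); rewrite rmorphM /= -!nrmE normrM. Qed.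

Lemma nrmZ (R : realType) (V : normedModType R[i]) (c : R[i]) (x : V) :
  nrm (c *: x) = nrm c * nrm x.
Proof. by apply: (@complexI R); rewrite rmorphM /= -!nrmE normrZ. Qed.

Lemma nrm_real (R : realType) (r : R) : nrm (r%:C : R[i]) = `|r|.
Proof. by rewrite /nrm normc_def /= expr0n addr0 sqrtr_sqr. Qed.

Lemma nrmi (R : realType) : nrm ('i : R[i]) = 1.
Proof. by rewrite /nrm normc_def /= expr0n add0r expr1n sqrtr1. Qed.

HB.mixin Record isNormedStarAlgebra (R : realType) A & NormedModule R[i] A := {
  amul : A -> A -> A;
  star : A -> A;
  amulA : associative amul;
  amulDl : left_distributive amul +%R;
  amulDr : right_distributive amul +%R;
  amulZl : forall (c : R[i]) x y, amul (c *: x) y = c *: amul x y;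
  amulZr : forall (c : R[i]) x y, amul x (c *: y) = c *: amul x y;
  starD : {morph star : x y / x + y};
  starZ : forall (c : R[i]) x, star (c *: x) = c^* *: star x;
  starK : involutive star;
  starM : forall x y, star (amul x y) = amul (star y) (star x);
  norm_amul : forall x y : A, `|amul x y| <= `|x| * `|y|;
  norm_star : forall x : A, `|star x| = `|x|
}.

(* Complex normed *-algebras, not necessarily unital nor complete: the common
   setting for C*-algebras, their subalgebras, and quotients of these, which are
   only ever used through their algebraic operations and norm. *)
#[short(type="nstarAlgType")]
HB.structure Definition NormedStarAlgebra (R : realType) :=
  {A of NormedModule R[i] A & isNormedStarAlgebra R A}.

HB.mixin Record hasCstarIdentity (R : realType) A & NormedStarAlgebra R A := {
  cstar_identity : forall x : A, `|amul (star x) x| = `|x| ^+ 2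
}.

#[short(type="cstarAlgType")]
HB.structure Definition CstarAlgebra (R : realType) :=
  {A of NormedStarAlgebra R A & Complete A & hasCstarIdentity R A}.

Reserved Notation "x ** y" (at level 40, left associativity).
Notation "x ** y" := (amul x y) : ring_scope.

Section StarAlgebraTheory.
Variables (R : realType) (B : nstarAlgType R).
Implicit Types x y z : B.

Lemma amul0r x : 0 ** x = 0.
Proof. by rewrite -[X in X ** _](scale0r (0 : B)) amulZl scale0r. Qed.
Lemma amulr0 x : x ** 0 = 0.
Proof. by rewrite -[X in _ ** X](scale0r (0 : B)) amulZr scale0r. Qed.
Lemma amulNr x y : x ** (- y) = - (x ** y).
Proof. by rewrite -scaleN1r amulZr scaleN1r. Qed.
Lemma amulNl x y : (- x) ** y = - (x ** y).
Proof. by rewrite -scaleN1r amulZl scaleN1r. Qed.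
Lemma amulBr x y z : x ** (y - z) = x ** y - x ** z.
Proof. by rewrite amulDr amulNr. Qed.
Lemma amulBl x y z : (x - y) ** z = x ** z - y ** z.
Proof. by rewrite amulDl amulNl. Qed.
Lemma star0 : star (0 : B) = 0.
Proof. by rewrite -[X in star X](scale0r (0 : B)) starZ conjC0 scale0r. Qed.
Lemma starN x : star (- x) = - star x.
Proof. by rewrite -scaleN1r starZ conjCN1 scaleN1r. Qed.
Lemma starB x y : star (x - y) = star x - star y.
Proof. by rewrite starD starN. Qed.

Lemma nrm_amul x y : nrm (x ** y) <= nrm x * nrm y.
Proof. by rewrite -lecR rmorphM /= -!nrmE norm_amul. Qed.
Lemma nrm_star x : nrm (star x) = nrm x.
Proof. by rewrite /nrm norm_star. Qed.

End StarAlgebraTheory.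

Lemma nrm_cstar (R : realType) (A : cstarAlgType R) (x : A) :
  nrm (star x ** x) = nrm x ^+ 2.
Proof. by apply: (@complexI R); rewrite rmorphXn /= -!nrmE cstar_identity. Qed.

Section Scalars.
Variable R : realType.
Let C : normedModType R[i] := R[i]^o.

Let cA : associative (fun x y : C => x * y : C). Proof. exact: mulrA. Qed.
Let cDl : left_distributive (fun x y : C => x * y : C) +%R.
Proof. exact: mulrDl. Qed.
Let cDr : right_distributive (fun x y : C => x * y : C) +%R.
Proof. exact: mulrDr. Qed.
Let cZl (c : R[i]) (x y : C) : (c *: x) * y = c *: (x * y) :> C.
Proof. by rewrite /GRing.scale /= mulrA. Qed.
Let cZr (c : R[i]) (x y : C) : x * (c *: y) = c *: (x * y) :> C.
Proof. by rewrite /GRing.scale /= mulrCA. Qed.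
Let sD : {morph (fun x : C => x^* : C) : x y / x + y}.
Proof. exact: rmorphD. Qed.
Let sZ (c : R[i]) (x : C) : (c *: x)^* = c^* *: (x^* : C) :> C.
Proof. by rewrite /GRing.scale /= rmorphM. Qed.
Let sK : involutive (fun x : C => x^* : C). Proof. exact: conjCK. Qed.
Let sM (x y : C) : (x * y)^* = y^* * x^* :> C.
Proof. by rewrite rmorphM mulrC. Qed.
Let nM (x y : C) : `|(x * y : C)| <= `|x| * `|y|.
Proof. by rewrite normrM. Qed.
Let ns (x : C) : `|(x^* : C)| = `|x|. Proof. exact: norm_conjC. Qed.

HB.instance Definition _ := isNormedStarAlgebra.Build R R[i]^o
  cA cDl cDr cZl cZr sD sZ sK sM nM ns.
End Scalars.

(* Bounded functions T -> B with pointwise operations and the supremum norm. *)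
Section BoundedFunctions.
Variables (R : realType) (T : Type) (B : nstarAlgType R).

Definition nbounded (f : T -> B) : bool :=
  `[< exists M : R, forall t, nrm (f t) <= M >].

Record linfty := Linfty {linfty_fun :> T -> B; _ : nbounded linfty_fun}.

HB.instance Definition _ := [isSub for linfty_fun].
HB.instance Definition _ := [Choice of linfty by <:].

Lemma linftyP (x : linfty) : nbounded x. Proof. by case: x. Qed.

Lemma linfty_ext (x y : linfty) : (forall t, x t = y t) -> x = y.
Proof. by move=> xy; apply: val_inj; apply/funext => t; exact: xy. Qed.

Lemma nbounded_submod : subsemimod_closed (nbounded : pred (T -> B)).
Proof.
split; first split.
- by apply/asboolP; exists 0 => t; rewrite nrm0.
- move=> f g /asboolP[M fM] /asboolP[N gN]; apply/asboolP; exists (M + N) => t.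
  by apply: (le_trans (nrmD _ _)); rewrite lerD.
- move=> c f /asboolP[M fM]; apply/asboolP; exists (nrm c * M) => t.
  by rewrite nrmZ ler_wpM2l// nrm_ge0.
Qed.

HB.instance Definition _ :=
  GRing.SubChoice_isSubLmodule.Build R[i] (T -> B) nbounded linfty
    nbounded_submod.

Lemma linftyD (x y : linfty) t : (x + y) t = x t + y t. Proof. by []. Qed.
Lemma linftyZ (c : R[i]) (x : linfty) t : (c *: x) t = c *: x t.
Proof. by []. Qed.
Lemma linfty0 t : (0 : linfty) t = 0. Proof. by []. Qed.

Definition linfty_nrm (x : linfty) : R := sup (range (fun t => nrm (x t))).

Lemma nrm_le_linfty (x : linfty) t : nrm (x t) <= linfty_nrm x.
Proof.
have /asboolP[M xM] := linftyP x.
apply: ub_le_sup; last by exists t.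
by exists M => _ [s _ <-].
Qed.

Lemma linfty_nrm_ge0 (x : linfty) : 0 <= linfty_nrm x.
Proof.
rewrite /linfty_nrm; have [[_ [t _ _]]|/set0P/negP/negPn/eqP ->] :=
  pselect (range (fun t => nrm (x t)) !=set0); last by rewrite sup0.
exact: le_trans (nrm_ge0 _) (nrm_le_linfty x t).
Qed.

Lemma linfty_nrm_le (x : linfty) (M : R) :
  0 <= M -> (forall t, nrm (x t) <= M) -> linfty_nrm x <= M.
Proof.
move=> M0 xM; rewrite /linfty_nrm.
have [[_ [t _ _]]|/set0P/negP/negPn/eqP ->] :=
  pselect (range (fun t => nrm (x t)) !=set0); last by rewrite sup0.
by apply: ge_sup; [exists (nrm (x t)), t|move=> _ [s _ <-]].
Qed.

Let norm (x : linfty) : R[i] := (linfty_nrm x)%:C.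

Let normD x y : norm (x + y) <= norm x + norm y.
Proof.
rewrite -rmorphD lecR; apply: linfty_nrm_le => [|t].
  by rewrite addr_ge0 ?linfty_nrm_ge0.
rewrite linftyD (le_trans (nrmD _ _))// lerD//; exact: nrm_le_linfty.
Qed.

Let linfty_nrmZ_le (c : R[i]) (x : linfty) :
  linfty_nrm (c *: x) <= nrm c * linfty_nrm x.
Proof.
apply: linfty_nrm_le => [|t]; first by rewrite mulr_ge0 ?nrm_ge0 ?linfty_nrm_ge0.
by rewrite linftyZ nrmZ ler_wpM2l ?nrm_ge0 ?nrm_le_linfty.
Qed.

Let normZ (c : R[i]) (x : linfty) : norm (c *: x) = `|c| * norm x.
Proof.
rewrite nrmE -rmorphM; congr (_%:C); apply/eqP; rewrite eq_le linfty_nrmZ_le /=.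
have [->|c0] := eqVneq c 0; first by rewrite nrm0 mul0r linfty_nrm_ge0.
have c0' : nrm c != 0 by apply: contra_neq c0 => /nrm_eq0.
have cp : 0 < nrm c by rewrite lt_neqAle eq_sym c0' nrm_ge0.
rewrite mulrC -ler_pdivlMr// mulrC.
apply: le_trans (_ : linfty_nrm (c^-1 *: (c *: x)) <= _).
  by rewrite scalerA mulVf// scale1r.
apply: le_trans (linfty_nrmZ_le _ _) _.
rewrite le_eqVlt; apply/orP; left; apply/eqP; congr (_ * _).
by apply: (mulfI c0'); rewrite -nrmM !mulfV// /nrm normr1.
Qed.

Let norm_eq0 (x : linfty) : norm x = 0 -> x = 0.
Proof.
move=> /(@complexI R) x0; apply: linfty_ext => t; apply: nrm_eq0; apply/eqP.
by rewrite eq_le nrm_ge0 andbT -x0 nrm_le_linfty.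
Qed.

HB.instance Definition _ :=
  Lmodule_isNormed.Build R[i] linfty normD normZ norm_eq0.

Lemma linfty_nrmE (x : linfty) : nrm x = linfty_nrm x.
Proof. by []. Qed.

Fact linfty_mul_subproof (x y : linfty) : nbounded (fun t => x t ** y t).
Proof.
apply/asboolP; exists (linfty_nrm x * linfty_nrm y) => t.
by rewrite (le_trans (nrm_amul _ _))// ler_pM ?nrm_ge0 ?nrm_le_linfty.
Qed.
Definition linfty_mul x y := Linfty (linfty_mul_subproof x y).

Fact linfty_star_subproof (x : linfty) : nbounded (fun t => star (x t)).
Proof.
by apply/asboolP; exists (linfty_nrm x) => t; rewrite nrm_star nrm_le_linfty.
Qed.
Definition linfty_star x := Linfty (linfty_star_subproof x).

Let mA : associative linfty_mul.
Proof. by move=> x y z; apply: linfty_ext => t; exact: amulA. Qed.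
Let mDl : left_distributive linfty_mul +%R.
Proof. by move=> x y z; apply: linfty_ext => t; exact: amulDl. Qed.
Let mDr : right_distributive linfty_mul +%R.
Proof. by move=> x y z; apply: linfty_ext => t; exact: amulDr. Qed.
Let mZl (c : R[i]) x y : linfty_mul (c *: x) y = c *: linfty_mul x y.
Proof. by apply: linfty_ext => t; exact: amulZl. Qed.
Let mZr (c : R[i]) x y : linfty_mul x (c *: y) = c *: linfty_mul x y.
Proof. by apply: linfty_ext => t; exact: amulZr. Qed.
Let sD : {morph linfty_star : x y / x + y}.
Proof. by move=> x y; apply: linfty_ext => t; exact: starD. Qed.
Let sZ (c : R[i]) x : linfty_star (c *: x) = c^* *: linfty_star x.
Proof. by apply: linfty_ext => t; exact: starZ. Qed.
Let sK : involutive linfty_star.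
Proof. by move=> x; apply: linfty_ext => t; exact: starK. Qed.
Let sM x y : linfty_star (linfty_mul x y) =
  linfty_mul (linfty_star y) (linfty_star x).
Proof. by apply: linfty_ext => t; exact: starM. Qed.
Let nM (x y : linfty) : `|linfty_mul x y| <= `|x| * `|y|.
Proof.
rewrite !nrmE -rmorphM lecR !linfty_nrmE; apply: linfty_nrm_le => [|t].
  by rewrite mulr_ge0 ?linfty_nrm_ge0.
by rewrite (le_trans (nrm_amul _ _))// ler_pM ?nrm_ge0 ?nrm_le_linfty.
Qed.
Let ns (x : linfty) : `|linfty_star x| = `|x|.
Proof.
rewrite !nrmE !linfty_nrmE /linfty_nrm; congr (sup _)%:C.
by apply: eq_imagel => t _ /=; rewrite nrm_star.
Qed.

HB.instance Definition _ := isNormedStarAlgebra.Build R linfty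
  mA mDl mDr mZl mZr sD sZ sK sM nM ns.

Lemma linftyM (x y : linfty) t : (x ** y) t = x t ** y t. Proof. by []. Qed.
Lemma linfty_starE (x : linfty) t : star x t = star (x t). Proof. by []. Qed.

End BoundedFunctions.
Arguments nbounded {R T B} f.

Record star_subalg (R : realType) (B : nstarAlgType R) := StarSubalg {
  ssa_set :> set B;
  ssa0 : ssa_set 0;
  ssaD : forall x y, ssa_set x -> ssa_set y -> ssa_set (x + y);
  ssaZ : forall (c : R[i]) x, ssa_set x -> ssa_set (c *: x);
  ssaM : forall x y, ssa_set x -> ssa_set y -> ssa_set (x ** y);
  ssa_star : forall x, ssa_set x -> ssa_set (star x)
}.

Section SubAlgebra.
Variables (R : realType) (B : nstarAlgType R) (S : star_subalg B).

Definition in_ssa : pred B := fun x => `[< ssa_set S x >].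

Record ssa_type := SsaType {ssa_val :> B; _ : in_ssa ssa_val}.

HB.instance Definition _ := [isSub for ssa_val].
HB.instance Definition _ := [Choice of ssa_type by <:].

Lemma ssa_valP (x : ssa_type) : ssa_set S (ssa_val x).
Proof. by case: x => x /= /asboolP. Qed.

Lemma ssa_ext (x y : ssa_type) : ssa_val x = ssa_val y -> x = y.
Proof. exact: val_inj. Qed.

Definition to_ssa (x : B) (Sx : ssa_set S x) : ssa_type :=
  @SsaType x (introT (asboolP (ssa_set S x)) Sx).

Lemma in_ssa_submod : subsemimod_closed in_ssa.
Proof.
split; first split.
- by apply/asboolP; exact: ssa0.
- by move=> x y /asboolP Sx /asboolP Sy; apply/asboolP; exact: ssaD.
- by move=> c x /asboolP Sx; apply/asboolP; exact: ssaZ.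
Qed.

HB.instance Definition _ :=
  GRing.SubChoice_isSubLmodule.Build R[i] B in_ssa ssa_type in_ssa_submod.

Lemma ssa_valD (x y : ssa_type) : ssa_val (x + y) = ssa_val x + ssa_val y.
Proof. by []. Qed.
Lemma ssa_valZ (c : R[i]) (x : ssa_type) : ssa_val (c *: x) = c *: ssa_val x.
Proof. by []. Qed.
Lemma ssa_val0 : ssa_val (0 : ssa_type) = 0. Proof. by []. Qed.

Let norm (x : ssa_type) : R[i] := `|ssa_val x|.
Let normD x y : norm (x + y) <= norm x + norm y.
Proof. exact: ler_normD. Qed.
Let normZ (c : R[i]) (x : ssa_type) : norm (c *: x) = `|c| * norm x.
Proof. exact: normrZ. Qed.
Let norm_eq0 (x : ssa_type) : norm x = 0 -> x = 0.
Proof. by move=> /normr0_eq0 x0; exact: ssa_ext. Qed.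

HB.instance Definition _ :=
  Lmodule_isNormed.Build R[i] ssa_type normD normZ norm_eq0.

Lemma ssa_nrmE (x : ssa_type) : nrm x = nrm (ssa_val x).
Proof. by []. Qed.

Definition ssa_mul (x y : ssa_type) := to_ssa (ssaM (ssa_valP x) (ssa_valP y)).
Definition ssa_starop (x : ssa_type) := to_ssa (ssa_star (ssa_valP x)).

Let mA : associative ssa_mul.
Proof. by move=> x y z; apply: ssa_ext; exact: amulA. Qed.
Let mDl : left_distributive ssa_mul +%R.
Proof. by move=> x y z; apply: ssa_ext; exact: amulDl. Qed.
Let mDr : right_distributive ssa_mul +%R.
Proof. by move=> x y z; apply: ssa_ext; exact: amulDr. Qed.
Let mZl (c : R[i]) x y : ssa_mul (c *: x) y = c *: ssa_mul x y.
Proof. by apply: ssa_ext; exact: amulZl. Qed.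
Let mZr (c : R[i]) x y : ssa_mul x (c *: y) = c *: ssa_mul x y.
Proof. by apply: ssa_ext; exact: amulZr. Qed.
Let sD : {morph ssa_starop : x y / x + y}.
Proof. by move=> x y; apply: ssa_ext; exact: starD. Qed.
Let sZ (c : R[i]) x : ssa_starop (c *: x) = c^* *: ssa_starop x.
Proof. by apply: ssa_ext; exact: starZ. Qed.
Let sK : involutive ssa_starop.
Proof. by move=> x; apply: ssa_ext; exact: starK. Qed.
Let sM x y : ssa_starop (ssa_mul x y) = ssa_mul (ssa_starop y) (ssa_starop x).
Proof. by apply: ssa_ext; exact: starM. Qed.
Let nM (x y : ssa_type) : `|ssa_mul x y| <= `|x| * `|y|.
Proof. exact: norm_amul. Qed.
Let ns (x : ssa_type) : `|ssa_starop x| = `|x|.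
Proof. exact: norm_star. Qed.

HB.instance Definition _ := isNormedStarAlgebra.Build R ssa_type
  mA mDl mDr mZl mZr sD sZ sK sM nM ns.

Lemma ssa_valM (x y : ssa_type) : ssa_val (x ** y) = ssa_val x ** ssa_val y.
Proof. by []. Qed.
Lemma ssa_val_star (x : ssa_type) : ssa_val (star x) = star (ssa_val x).
Proof. by []. Qed.

End SubAlgebra.

(* Closed two-sided *-ideals and the quotient by such an ideal, with the
   quotient norm |x| = inf {|y| : y a representative of x}. *)
Record star_ideal (R : realType) (B : nstarAlgType R) := StarIdeal {
  ideal_set :> set B;
  ideal0 : ideal_set 0;
  idealD : forall x y, ideal_set x -> ideal_set y -> ideal_set (x + y);
  idealZ : forall (c : R[i]) x, ideal_set x -> ideal_set (c *: x);
  idealMl : forall x y, ideal_set y -> ideal_set (x ** y);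
  idealMr : forall x y, ideal_set x -> ideal_set (x ** y);
  ideal_star : forall x, ideal_set x -> ideal_set (star x);
  ideal_closed : closed ideal_set
}.

Section QuotientAlgebra.
Variables (R : realType) (B : nstarAlgType R) (I : star_ideal B).

Definition in_ideal : {pred B} := fun x => `[< ideal_set I x >].

Fact in_ideal_zmod : zmod_closed in_ideal.
Proof.
split; first by apply/asboolP; exact: ideal0.
move=> x y /asboolP Ix /asboolP Iy; apply/asboolP.
by apply: idealD => //; rewrite -scaleN1r; exact: idealZ.
Qed.
HB.instance Definition _ := GRing.isZmodClosed.Build B in_ideal in_ideal_zmod.

Definition quot_alg := @Quotient.quot B in_ideal.
HB.instance Definition _ := GRing.Zmodule.on quot_alg.

Definition quot_pi (x : B) : quot_alg := \pi_(@Quotient.quot B in_ideal)%qT x.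
Definition quot_repr (x : quot_alg) : B := repr x.

Lemma quot_reprK x : quot_pi (quot_repr x) = x.
Proof. exact: reprK. Qed.

Lemma quot_piP x y : quot_pi x = quot_pi y <-> ideal_set I (x - y).
Proof.
split => [/eqP|Ixy].
  by rewrite -Quotient.idealrBE => /asboolP.
by apply/eqP; rewrite -Quotient.idealrBE; apply/asboolP.
Qed.

Lemma quot_piD x y : quot_pi (x + y) = quot_pi x + quot_pi y.
Proof. exact: pi_addr. Qed.

Lemma quot_reprP x : ideal_set I (quot_repr (quot_pi x) - x).
Proof. by apply/quot_piP; rewrite quot_reprK. Qed.

Let lift1 (f : B -> B) :
  (forall x y, ideal_set I (x - y) -> ideal_set I (f x - f y)) ->
  forall x, quot_pi (f (quot_repr (quot_pi x))) = quot_pi (f x).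
Proof. by move=> fI x; apply/quot_piP/fI/quot_reprP. Qed.

Definition quot_scale (c : R[i]) (x : quot_alg) := quot_pi (c *: quot_repr x).
Definition quot_mul (x y : quot_alg) := quot_pi (quot_repr x ** quot_repr y).
Definition quot_star (x : quot_alg) := quot_pi (star (quot_repr x)).

Let piZ c x : quot_scale c (quot_pi x) = quot_pi (c *: x).
Proof.
by apply: (lift1 (f := *:%R c)) => a b Iab; rewrite -scalerBr; exact: idealZ.
Qed.

Let pi_star x : quot_star (quot_pi x) = quot_pi (star x).
Proof. by apply: lift1 => a b Iab; rewrite -starB; exact: ideal_star. Qed.

Let piM x y : quot_mul (quot_pi x) (quot_pi y) = quot_pi (x ** y).
Proof.
apply/quot_piP; set a := quot_repr _; set b := quot_repr _.
rewrite -(subrK (x ** b) (a ** b)) -addrA -amulBl -amulBr.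
by apply: idealD; [apply: idealMr|apply: idealMl]; exact: quot_reprP.
Qed.

Let scaleA c d x : quot_scale c (quot_scale d x) = quot_scale (c * d) x.
Proof. by rewrite -[x]quot_reprK !piZ scalerA. Qed.
Let scale1 : left_id 1 quot_scale.
Proof. by move=> x; rewrite -[x]quot_reprK piZ scale1r. Qed.
Let scaleDr : right_distributive quot_scale +%R.
Proof.
move=> c x y; rewrite -[x]quot_reprK -[y]quot_reprK.
by rewrite -quot_piD !piZ scalerDr quot_piD.
Qed.
Let scaleDl x : {morph quot_scale^~ x : c d / c + d}.
Proof. by move=> c d; rewrite -[x]quot_reprK !piZ scalerDl quot_piD. Qed.

HB.instance Definition _ :=
  GRing.Zmodule_isLmodule.Build R[i] quot_alg scaleA scale1 scaleDr scaleDl.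

Lemma quot_piZ c x : quot_pi (c *: x) = c *: quot_pi x.
Proof. by rewrite -piZ. Qed.

Lemma quot_pi0 : quot_pi 0 = 0.
Proof. by rewrite -(scale0r (0 : B)) quot_piZ scale0r. Qed.

Lemma quot_piB x y : quot_pi (x - y) = quot_pi x - quot_pi y.
Proof. by rewrite quot_piD -scaleN1r quot_piZ scaleN1r. Qed.

Definition quot_nrm (x : quot_alg) : R :=
  inf [set nrm y | y in quot_pi @^-1` [set x]].

Let has_inf_nrm x : has_inf [set nrm y | y in quot_pi @^-1` [set x]].
Proof.
split; last by exists 0 => _ [y _ <-]; exact: nrm_ge0.
by exists (nrm (quot_repr x)), (quot_repr x) => //; exact: quot_reprK.
Qed.

Lemma quot_nrm_le x : quot_nrm (quot_pi x) <= nrm x.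
Proof. by apply: ge_inf; [case: (has_inf_nrm (quot_pi x))|exists x]. Qed.

Lemma quot_nrm_adh x (e : R) : 0 < e ->
  exists2 y, quot_pi y = x & nrm y < quot_nrm x + e.
Proof.
by move=> /inf_adherent/(_ (has_inf_nrm x))[_ [y yx <-] ?]; exists y.
Qed.

Lemma quot_nrm_ge0 x : 0 <= quot_nrm x.
Proof.
apply: lb_le_inf; first by case: (has_inf_nrm x).
by move=> _ [y _ <-]; exact: nrm_ge0.
Qed.

Let norm (x : quot_alg) : R[i] := (quot_nrm x)%:C.

Let normD x y : norm (x + y) <= norm x + norm y.
Proof.
rewrite -rmorphD lecR; apply/ler_addgt0Pr => e e0.
have e2 : 0 < e / 2 by rewrite divr_gt0.
have [a <- ae] := quot_nrm_adh x e2; have [b <- be] := quot_nrm_adh y e2.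
rewrite -quot_piD (le_trans (quot_nrm_le _))// (le_trans (nrmD _ _))//.
by rewrite [e]splitr addrACA ltW// ltrD.
Qed.

Let nrmZ_le (c : R[i]) x : quot_nrm (c *: x) <= nrm c * quot_nrm x.
Proof.
apply/ler_addgt0Pr => e e0.
have c1 : 0 < nrm c + 1 by rewrite ltr_wpDl ?nrm_ge0.
have [a <- ae] := quot_nrm_adh x (divr_gt0 e0 c1).
rewrite -quot_piZ (le_trans (quot_nrm_le _))// nrmZ.
rewrite (le_trans (ler_wpM2l (nrm_ge0 _) (ltW ae)))// mulrDr lerD2l.
rewrite mulrCA ger_pMr// ler_pdivrMr// mul1r lerDl//.
Qed.

Let normZ (c : R[i]) x : norm (c *: x) = `|c| * norm x.
Proof.
rewrite nrmE -rmorphM; congr (_%:C); apply/eqP; rewrite eq_le nrmZ_le /=.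
have [->|c0] := eqVneq c 0; first by rewrite nrm0 mul0r quot_nrm_ge0.
have c0' : nrm c != 0 by apply: contra_neq c0 => /nrm_eq0.
have cp : 0 < nrm c by rewrite lt_neqAle eq_sym c0' nrm_ge0.
rewrite mulrC -ler_pdivlMr// mulrC.
apply: le_trans (_ : quot_nrm (c^-1 *: (c *: x)) <= _).
  by rewrite scalerA mulVf// scale1r.
apply: le_trans (nrmZ_le _ _) _.
rewrite le_eqVlt; apply/orP; left; apply/eqP; congr (_ * _).
by apply: (mulfI c0'); rewrite -nrmM !mulfV// /nrm normr1.
Qed.

Let norm_eq0 x : norm x = 0 -> x = 0.
Proof.
move=> /(@complexI R) x0; rewrite -[x]quot_reprK -quot_pi0; apply/quot_piP.
rewrite subr0; apply: ideal_closed => U.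
rewrite -nbhs_ballE => -[e /= e0 eU].
have e0' : 0 < complex.Re e.
  by rewrite -ltcR RRe_real// gtr0_real.
have [y yx ye] := quot_nrm_adh x e0'.
exists (quot_repr x - y); split; first by apply/quot_piP; rewrite quot_reprK.
apply: eU; rewrite -ball_normE /ball_ /= opprB addrC subrK nrmE.
by rewrite -(RRe_real (gtr0_real e0)) ltcR (lt_le_trans ye)// x0 add0r.
Qed.

HB.instance Definition _ :=
  Lmodule_isNormed.Build R[i] quot_alg normD normZ norm_eq0.

Lemma quot_nrmE (x : quot_alg) : nrm x = quot_nrm x.
Proof. by []. Qed.

Let mA : associative quot_mul.
Proof.
move=> x y z; rewrite -[x]quot_reprK -[y]quot_reprK -[z]quot_reprK.
by rewrite !piM amulA.
Qed.
Let mDl : left_distributive quot_mul +%R.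
Proof.
move=> x y z; rewrite -[x]quot_reprK -[y]quot_reprK -[z]quot_reprK.
by rewrite -quot_piD !piM amulDl quot_piD.
Qed.
Let mDr : right_distributive quot_mul +%R.
Proof.
move=> x y z; rewrite -[x]quot_reprK -[y]quot_reprK -[z]quot_reprK.
by rewrite -quot_piD !piM amulDr quot_piD.
Qed.
Let mZl (c : R[i]) x y : quot_mul (c *: x) y = c *: quot_mul x y.
Proof.
rewrite -[x]quot_reprK -[y]quot_reprK.
by rewrite -quot_piZ !piM amulZl quot_piZ.
Qed.
Let mZr (c : R[i]) x y : quot_mul x (c *: y) = c *: quot_mul x y.
Proof.
rewrite -[x]quot_reprK -[y]quot_reprK.
by rewrite -quot_piZ !piM amulZr quot_piZ.
Qed.
Let sD : {morph quot_star : x y / x + y}.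
Proof.
move=> x y; rewrite -[x]quot_reprK -[y]quot_reprK.
by rewrite -quot_piD !pi_star starD quot_piD.
Qed.
Let sZ (c : R[i]) x : quot_star (c *: x) = c^* *: quot_star x.
Proof. by rewrite -[x]quot_reprK -quot_piZ !pi_star starZ quot_piZ. Qed.
Let sK : involutive quot_star.
Proof. by move=> x; rewrite -[x]quot_reprK !pi_star starK. Qed.
Let sM x y : quot_star (quot_mul x y) = quot_mul (quot_star y) (quot_star x).
Proof.
by rewrite -[x]quot_reprK -[y]quot_reprK !(piM, pi_star) starM.
Qed.
Let nM (x y : quot_alg) : `|quot_mul x y| <= `|x| * `|y|.
Proof.
rewrite !nrmE -rmorphM lecR !quot_nrmE.
apply/ler_addgt0Pr => e e0.
set p := quot_nrm x; set q := quot_nrm y.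
have p0 : 0 <= p := quot_nrm_ge0 x; have q0 : 0 <= q := quot_nrm_ge0 y.
pose d := Num.min 1 (e / (p + q + 1)).
have k0 : 0 < p + q + 1 by rewrite ltr_wpDl ?addr_ge0.
have d0 : 0 < d by rewrite lt_min ltr01 divr_gt0.
have [a ax ae] := quot_nrm_adh x d0; have [b yb be] := quot_nrm_adh y d0.
rewrite -ax -yb piM (le_trans (quot_nrm_le _))// (le_trans (nrm_amul _ _))//.
apply: le_trans (ler_pM (nrm_ge0 _) (nrm_ge0 _) (ltW ae) (ltW be)) _.
rewrite -/p -/q.
have dk : d * (p + q + 1) <= e.
  by rewrite -ler_pdivlMr// /d ge_min lexx orbT.
have d1 : d <= 1 by rewrite /d ge_min lexx.
have : d * d <= d by rewrite ger_pMr.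
move: dk; rewrite !mulrDr mulr1 => dk dd.
by rewrite !mulrDl (mulrC p d); lra.
Qed.
Let ns_le (x : quot_alg) : quot_nrm (quot_star x) <= quot_nrm x.
Proof.
apply/ler_addgt0Pr => e e0; have [a <- ae] := quot_nrm_adh x e0.
by rewrite pi_star (le_trans (quot_nrm_le _))// nrm_star ltW.
Qed.
Let ns (x : quot_alg) : `|quot_star x| = `|x|.
Proof.
rewrite !nrmE !quot_nrmE; congr (_%:C); apply/eqP; rewrite eq_le ns_le /=.
by rewrite -[in leLHS](sK x) ns_le.
Qed.

HB.instance Definition _ := isNormedStarAlgebra.Build R quot_alg
  mA mDl mDr mZl mZr sD sZ sK sM nM ns.

Lemma quot_piM x y : quot_pi (x ** y) = quot_pi x ** quot_pi y.
Proof. by rewrite -piM. Qed.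

Lemma quot_pi_star x : quot_pi (star x) = star (quot_pi x).
Proof. by rewrite -pi_star. Qed.

End QuotientAlgebra.

Lemma nrm_closed (R : realType) (V : normedModType R[i]) (S : set V) :
  (forall x, (forall e : R, 0 < e -> exists2 y, S y & nrm (x - y) < e) -> S x) ->
  closed S.
Proof.
move=> hS x xS; apply: hS => e e0.
have e0' : 0 < e%:C by rewrite ltcR.
have [y [Sy]] := xS _ (nbhsx_ballx x e%:C e0').
by rewrite -ball_normE /ball_ /= nrmE ltcR => xy; exists y.
Qed.

(* *-homomorphisms of C*-algebras are contractive, so that they act on bounded
   sequences. *)
Section StarHomomorphisms.
Variable R : realType.

Lemma nrm_small (V : normedZmodType R[i]) (x : V) (K : R) :
  (forall e : R, 0 < e -> nrm x <= K * e) -> x = 0.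
Proof.
move=> xK; apply: nrm_eq0; apply/eqP; rewrite eq_le nrm_ge0 andbT.
have K1 : 0 < `|K| + 1 by rewrite ltr_wpDl.
apply/ler_addgt0Pr => e e0; rewrite add0r.
apply: le_trans (xK _ (divr_gt0 e0 K1)) _.
rewrite mulrCA ger_pMr// ler_pdivrMr// mul1r.
by rewrite (le_trans (ler_norm _))// lerDl.
Qed.

Lemma cvg_nrm (V : normedModType R[i]) (u : nat -> V) (l : V) (e : R) :
  u @ \oo --> l -> 0 < e -> \forall n \near \oo, nrm (l - u n) < e.
Proof.
move=> /cvgrPdist_lt ul e0; have e0' : 0 < e%:C by rewrite ltcR.
by near=> n; rewrite -ltcR -nrmE; near: n; exact: ul.
Unshelve. all: by end_near. Qed.

Lemma nrm_cvg (V : normedModType R[i]) (u : nat -> V) (l : V) :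
  (forall e : R, 0 < e -> \forall n \near \oo, nrm (l - u n) < e) ->
  u @ \oo --> l.
Proof.
move=> ul; apply/cvgrPdist_lt => e e0.
have e0' : 0 < complex.Re e by rewrite -ltcR RRe_real// gtr0_real.
have := ul _ e0'; apply: filterS => n.
by rewrite nrmE -[in X in _ -> X](RRe_real (gtr0_real e0)) ltcR.
Qed.

Section SquareRoot.
Variables (A : cstarAlgType R) (b : A).
Hypotheses (bs : star b = b) (b1 : nrm b < 1).

Let c := fix c n : A :=
  if n is m.+1 then (2^-1 : R[i]) *: (b ** b + c m ** c m) else 0.

Let nrm2V : nrm (2^-1 : R[i]) = 2^-1.
Proof.
have -> : (2^-1 : R[i]) = (2^-1 : R)%:C by rewrite fmorphV rmorph_nat.
by rewrite nrm_real ger0_norm.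
Qed.

Let c_le n : nrm (c n) <= nrm b.
Proof.
elim: n => [|n IH] /=; first by rewrite nrm0 nrm_ge0.
rewrite nrmZ nrm2V; have b0 := nrm_ge0 b; have c0 := nrm_ge0 (c n).
have h1 := nrmD (b ** b) (c n ** c n); have h2 := nrm_amul b b.
have h3 := nrm_amul (c n) (c n).
have h4 : nrm (c n) * nrm (c n) <= nrm b * nrm b by rewrite ler_pM.
have h5 : nrm b * nrm b <= nrm b by rewrite -[leRHS]mulr1 ler_wpM2l// ltW.
lra.
Qed.

Let cS n : nrm (c n.+1 - c n) <= nrm b ^+ n.
Proof.
have b0 := nrm_ge0 b; elim: n => [|n IH].
  rewrite subr0 expr0; apply: le_trans (c_le 1) _; exact: ltW.
have -> : c n.+2 - c n.+1 =
    (2^-1 : R[i]) *: (c n.+1 ** (c n.+1 - c n) + (c n.+1 - c n) ** c n).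
  rewrite amulBr amulBl addrA subrK {1}/c -/c [in X in _ - X]/c -/c.
  by rewrite -scalerBr opprD addrACA subrr add0r.
rewrite nrmZ nrm2V exprS; set d := c n.+1 - c n.
have h1 := nrmD (c n.+1 ** d) (d ** c n).
have h2 := nrm_amul (c n.+1) d; have h3 := nrm_amul d (c n).
have h4 : nrm (c n.+1) * nrm d <= nrm b * nrm b ^+ n.
  by rewrite ler_pM ?nrm_ge0.
have h5 : nrm d * nrm (c n) <= nrm b * nrm b ^+ n.
  by rewrite mulrC ler_pM ?nrm_ge0.
lra.
Qed.

Let c_tail n k :
  (1 - nrm b) * nrm (c (n + k) - c n) <= nrm b ^+ n - nrm b ^+ (n + k).
Proof.
elim: k => [|k IH]; first by rewrite addn0 !subrr nrm0 mulr0.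
have b0 := nrm_ge0 b; have h := cS (n + k).
have h1 := nrmD (c (n + k.+1) - c (n + k)) (c (n + k) - c n).
rewrite addrA subrK addnS in h1; rewrite addnS exprS.
have : (1 - nrm b) * nrm (c (n + k).+1 - c n) <=
  (1 - nrm b) * (nrm b ^+ (n + k) + nrm (c (n + k) - c n)).
  by apply: ler_wpM2l; [rewrite subr_ge0 ltW|lra].
rewrite mulrDr mulrBl mul1r; lra.
Qed.

Let c_cvg : cvg (c @ \oo).
Proof.
apply/cauchy_cvgP; apply: cauchy_exP => e e0.
have e0' : 0 < complex.Re e by rewrite -ltcR RRe_real// gtr0_real.
have b0 := nrm_ge0 b; have b1' : 0 < 1 - nrm b by rewrite subr_gt0.
have : (fun n => nrm b ^+ n) @ \oo --> (0 : R).
  by apply: cvg_expr; rewrite ger0_norm.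
move=> /cvgrPdist_lt/(_ _ (mulr_gt0 b1' e0'))[N _ /(_ N (leqnn N))].
rewrite sub0r normrN ger0_norm ?exprn_ge0// => bN.
exists (c N); exists N => // m /= Nm.
rewrite -ball_normE /ball_ /= nrmE -(RRe_real (gtr0_real e0)) ltcR.
rewrite -(ltr_pM2l b1'); apply: le_lt_trans bN.
rewrite nrmB -(subnKC Nm); apply: le_trans (c_tail _ _) _.
by rewrite gerBl exprn_ge0.
Qed.

Let l := lim (c @ \oo).

Let c_near (e : R) : 0 < e ->
  exists n, nrm (l - c n) < e /\ nrm (l - c n.+1) < e.
Proof.
move=> e0; have [N _ hN] := cvg_nrm c_cvg e0.
by exists N; split; apply: hN => //=.
Qed.

Let c_star n : star (c n) = c n.
Proof.
elim: n => [|n IH] /=; first exact: star0.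
by rewrite starZ starD !starM bs IH fmorphV rmorph_nat.
Qed.

Let c_comm n : c n ** b = b ** c n.
Proof.
elim: n => [|n IH] /=; first by rewrite amul0r amulr0.
rewrite amulZl amulZr amulDl amulDr amulA; congr (_ *: (_ + _)).
by rewrite -amulA IH amulA IH amulA.
Qed.

Lemma cstar_sqrt_exists :
  exists c : A, [/\ star c = c, c ** b = b ** c & c + c = b ** b + c ** c].
Proof.
exists l; split; apply/eqP; rewrite -subr_eq0; apply/eqP.
- apply: (nrm_small (K := 2)) => e e0; have [n [h _]] := c_near e0.
  have -> : star l - l = star (l - c n) - (l - c n).
    by rewrite starB c_star opprB addrA subrK.
  by have := nrmD (star (l - c n)) (- (l - c n)); rewrite nrmN nrm_star; lra.
- apply: (nrm_small (K := 2 * nrm b)) => e e0; have [n [h _]] := c_near e0.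
  have -> : l ** b - b ** l = (l - c n) ** b - b ** (l - c n).
    by rewrite amulBl amulBr c_comm opprB addrA subrK.
  have h1 := nrmD ((l - c n) ** b) (- (b ** (l - c n))).
  have h2 := nrm_amul (l - c n) b; have h3 := nrm_amul b (l - c n).
  have h4 : nrm (l - c n) * nrm b <= e * nrm b.
    by rewrite ler_wpM2r ?nrm_ge0// ltW.
  rewrite nrmN in h1; lra.
- apply: (nrm_small (K := 2 + (nrm b + nrm l))) => e e0.
  have [n [h h']] := c_near e0.
  have cE : c n.+1 + c n.+1 = b ** b + c n ** c n.
    by rewrite /= -scalerDl -[in RHS](scale1r (_ + _)); congr (_ *: _); field.
  have -> : l + l - (b ** b + l ** l) = ((l - c n.+1) + (l - c n.+1)) -
      (c n ** (l - c n) + (l - c n) ** l).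
    rewrite amulBr amulBl [c n ** l - _ + _]addrC [_ + (c n ** l - _)]addrA.
    rewrite subrK [in RHS](addrACA l) -(opprD (c n.+1)) cE.
    by rewrite -[RHS]addrA -opprD (addrACA (b ** b)) subrr addr0.
  have h1 := nrmD ((l - c n.+1) + (l - c n.+1))
    (- (c n ** (l - c n) + (l - c n) ** l)).
  have h2 := nrmD (l - c n.+1) (l - c n.+1).
  have h3 := nrmD (c n ** (l - c n)) ((l - c n) ** l).
  have h4 := nrm_amul (c n) (l - c n); have h5 := nrm_amul (l - c n) l.
  have h6 : nrm (c n) * nrm (l - c n) <= nrm b * e.
    by rewrite ler_pM ?nrm_ge0// ltW.
  have h7 : nrm (l - c n) * nrm l <= e * nrm l.
    by rewrite ler_wpM2r ?nrm_ge0// ltW.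
  rewrite nrmN in h1; rewrite !mulrDl; lra.
Qed.

End SquareRoot.

Variables (A B : cstarAlgType R) (f : A -> B).
Hypotheses (f_lin : linear f) (fM : {morph f : x y / x ** y})
  (f_star : {morph f : x / star x}).

Let fZ (c : R[i]) x : f (c *: x) = c *: f x.
Proof.
have f0 : f 0 = 0.
  have := f_lin 1 0 0; rewrite !scale1r addr0 => /eqP.
  by rewrite -[eqbLHS]addr0 (inj_eq (addrI _)) eq_sym => /eqP.
by have := f_lin c x 0; rewrite f0 !addr0.
Qed.

Let fD x y : f (x + y) = f x + f y.
Proof. by have := f_lin 1 x y; rewrite !scale1r. Qed.

Let nrm_selfadj_lt1 b : star b = b -> nrm b < 1 -> nrm (f b) <= 1.
Proof.
move=> bs b1; have [c [cs cb cE]] := cstar_sqrt_exists bs b1.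
pose y := f b; pose z := f c.
have ys : star y = y by rewrite /y -f_star bs.
have zs : star z = z by rewrite /z -f_star cs.
have zy : z ** y = y ** z by rewrite /y /z -!fM cb.
have zE : z + z = y ** y + z ** z by rewrite /y /z -!fM -!fD cE.
(* w s a is "(y + s (1 - z)) a" computed without a unit; it has the norm of a
   for s = i and s = - i *)
pose w (s : R[i]) a := y ** a + s *: (a - z ** a).
have nw (s : R[i]) a : s^* = - s -> s ^+ 2 = -1 -> nrm (w s a) = nrm a.
  move=> sc s2; apply: (@pexpIrn _ 2) => //; try exact: nrm_ge0.
  rewrite -!nrm_cstar; congr (nrm _).
  rewrite /w starD starZ starB !starM ys zs sc.
  rewrite amulDl !amulDr !amulZl !amulZr scalerA mulNr -expr2 s2 opprK scale1r.
  rewrite !amulBr !amulBl !amulA.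
  have -> : star a ** z ** y ** a = star a ** y ** z ** a.
    by rewrite -[star a ** z ** y]amulA zy amulA.
  have XX : star a ** z ** a + star a ** z ** a =
      star a ** y ** y ** a + star a ** z ** z ** a.
    by rewrite -amulDl -amulDr zE amulDr amulDl !amulA.
  rewrite scaleNr addrA addrK -[star a ** a - _ - _]addrA -opprD.
  by rewrite [star a ** z ** a + (_ - _)]addrA XX addrK addrC subrK.
have nya a : nrm (y ** a) <= nrm a.
  have : nrm ((2 : R[i]) *: (y ** a)) <= nrm (w 'i a) + nrm (w (- 'i) a).
    apply: le_trans (nrmD _ _); rewrite /w addrACA -scalerDl subrr scale0r.
    by rewrite addr0 scaler_nat mulr2n.
  rewrite nrmZ !nw ?rmorphN /= ?conjCi ?sqrrN ?sqrCi//.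
  have -> : (2 : R[i]) = (2 : R)%:C by rewrite rmorph_nat.
  by rewrite nrm_real ger0_norm//; lra.
have [y0|y0] := eqVneq (nrm y) 0; first by rewrite y0 ler01.
have yp : 0 < nrm y by rewrite lt_neqAle eq_sym y0 nrm_ge0.
have := nya y; rewrite -{1}ys nrm_cstar expr2 -[leRHS]mul1r.
by rewrite ler_pM2r.
Qed.

Lemma star_hom_contractive x : nrm (f x) <= nrm x.
Proof.
have sa b : star b = b -> nrm (f b) <= nrm b.
  move=> bs; apply/ler_addgt0Pr => e e0; set k := nrm b + e.
  have k0 : 0 < k by rewrite ltr_wpDl ?nrm_ge0.
  have nk : nrm ((k^-1)%:C : R[i]) = k^-1.
    by rewrite nrm_real ger0_norm// invr_ge0 ltW.
  have /= := nrm_selfadj_lt1 (b := (k^-1)%:C *: b).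
  rewrite starZ bs fZ !nrmZ nk mulrC ltr_pdivrMr// mul1r.
  rewrite [leLHS]mulrC ler_pdivrMr// mul1r; apply; last by rewrite ltrDl.
  by rewrite conj_Creal// complex_real.
rewrite -(@ler_pXn2r _ 2) ?nnegrE ?nrm_ge0//.
rewrite -!nrm_cstar -f_star -fM; apply: sa; by rewrite starM starK.
Qed.

End StarHomomorphisms.

Section Subgroups.
Variables (G : groupType) (H : groupClosed G).

Definition in_subgroup : pred G := fun x => x \in H.

Record subgroup_type := SubgroupType {sg_val :> G; _ : in_subgroup sg_val}.

HB.instance Definition _ := [isSub for sg_val].
HB.instance Definition _ := [Choice of subgroup_type by <:].

Fact in_subgroup_closed : group_closed in_subgroup.
Proof.
by split; [exact: gpred1|move=> x y Hx Hy; apply: gpredM => //; exact: gpredVr].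
Qed.

HB.instance Definition _ :=
  SubChoice_isSubGroup.Build G in_subgroup subgroup_type in_subgroup_closed.

(* Left cosets: gL = hL iff g^-1 h belongs to L. *)
Definition coset_rel (x y : G) : bool := (x^-1 * y)%g \in H.

Fact coset_rel_equiv : equiv_class_of coset_rel.
Proof.
split=> [x|x y|y x z]; rewrite /coset_rel.
- by rewrite mulVg gpred1.
- by apply/idP/idP => /gpredVr; rewrite invgM invgK.
- by move=> xy yz; have := gpredM _ _ xy yz; rewrite mulgA mulgK.
Qed.
Canonical coset_rel_canonical := EquivRelPack coset_rel_equiv.
Canonical coset_rel_encModRel := defaultEncModRel coset_rel.

Definition coset_space := {eq_quot coset_rel}%qT.
HB.instance Definition _ := Choice.on coset_space.

Definition coset_pi (g : G) : coset_space := \pi_({eq_quot coset_rel})%qT g.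

Lemma coset_piP g h : coset_pi g = coset_pi h <-> (g^-1 * h)%g \in H.
Proof. by split=> [/eqP|?]; [|apply/eqP]; rewrite eqmodE. Qed.

Definition coset_act (t : G) (c : coset_space) : coset_space :=
  coset_pi (t * repr c)%g.

Lemma coset_actE t g : coset_act t (coset_pi g) = coset_pi (t * g)%g.
Proof.
apply/coset_piP; rewrite invgM mulgA -(mulgA _ t^-1%g) mulVg mulg1.
by apply/coset_piP; exact: reprK.
Qed.

Definition finite_index : Prop := finite_set [set: coset_space].

End Subgroups.

Definition residually_finite (G : groupType) : Prop :=
  forall g : G, g <> 1%g -> exists N : groupClosed G,
    [/\ finite_index N, forall x y : G, x \in N -> (x ^ y)%g \in N
      & g \notin N].

Definition retract (G : groupType) (H K : groupClosed G) : Prop :=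
  (forall h : G, h \in H -> h \in K) /\
  exists rho : G -> G,
    [/\ forall x, x \in K -> rho x \in H,
        forall x y, x \in K -> y \in K -> rho (x * y)%g = (rho x * rho y)%g
      & forall h, h \in H -> rho h = h].

Definition virtual_retract (G : groupType) (H : groupClosed G) : Prop :=
  exists K : groupClosed G, finite_index K /\ retract H K.

Section SequenceAlgebra.
Variables (R : realType) (A : cstarAlgType R).
Implicit Types x y : linfty nat A.

Definition c0_set : set (linfty nat A) :=
  [set x | (x : nat -> A) @ \oo --> (0 : A)].

Let c0P x : c0_set x <->
  forall e : R, 0 < e -> \forall n \near \oo, nrm (x n) < e.
Proof.
split=> [x0 e e0|h].
  by have := cvg_nrm x0 e0; apply: filterS => n; rewrite sub0r nrmN.
apply: nrm_cvg => e e0; have := h _ e0; apply: filterS => n.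
by rewrite sub0r nrmN.
Qed.

Let c0_bound x y (M : R) : 0 <= M -> (forall n, nrm (y n) <= M * nrm (x n)) ->
  c0_set x -> c0_set y.
Proof.
move=> M0 xy /c0P x0; apply/c0P => e e0.
have M1 : 0 < M + 1 by rewrite ltr_wpDl.
have := x0 _ (divr_gt0 e0 M1); apply: filterS => n; rewrite ltr_pdivlMr// => h.
apply: le_lt_trans (xy n) _; apply: le_lt_trans h; rewrite mulrC.
by rewrite ler_wpM2l ?nrm_ge0// lerDl.
Qed.

Fact c0_0 : c0_set 0.
Proof. by apply/c0P => e e0; near=> n; rewrite linfty0 nrm0.
Unshelve. all: by end_near. Qed.

Fact c0_D x y : c0_set x -> c0_set y -> c0_set (x + y).
Proof.
move=> /c0P x0 /c0P y0; apply/c0P => e e0.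
have e2 : 0 < e / 2 by rewrite divr_gt0.
near=> n; rewrite linftyD (le_lt_trans (nrmD _ _))// [e]splitr ltrD//.
  by near: n; exact: x0.
by near: n; exact: y0.
Unshelve. all: by end_near. Qed.

Fact c0_Z (c : R[i]) x : c0_set x -> c0_set (c *: x).
Proof.
by move=> x0; apply: c0_bound (nrm_ge0 c) _ x0 => n; rewrite linftyZ nrmZ.
Qed.

Fact c0_Ml x y : c0_set y -> c0_set (x ** y).
Proof.
move=> y0; apply: c0_bound (linfty_nrm_ge0 x) _ y0 => n.
by rewrite linftyM (le_trans (nrm_amul _ _))// ler_wpM2r ?nrm_ge0 ?nrm_le_linfty.
Qed.

Fact c0_Mr x y : c0_set x -> c0_set (x ** y).
Proof.
move=> x0; apply: c0_bound (linfty_nrm_ge0 y) _ x0 => n; rewrite mulrC.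
by rewrite linftyM (le_trans (nrm_amul _ _))// ler_wpM2l ?nrm_ge0 ?nrm_le_linfty.
Qed.

Fact c0_star x : c0_set x -> c0_set (star x).
Proof.
by move=> x0; apply: c0_bound ler01 _ x0 => n; rewrite linfty_starE nrm_star mul1r.
Qed.

Fact c0_closed : closed c0_set.
Proof.
apply: nrm_closed => x xc; apply/c0P => e e0.
have e2 : 0 < e / 2 by rewrite divr_gt0.
have [y /c0P y0 xy] := xc _ e2.
have := y0 _ e2; apply: filterS => n yn.
have -> : x n = (x - y) n + y n by rewrite linftyD addrNK.
rewrite (le_lt_trans (nrmD _ _))// [e]splitr ltrD//.
by rewrite (le_lt_trans _ xy)// linfty_nrmE nrm_le_linfty.
Qed.

Definition c0 : star_ideal (linfty nat A) :=
  StarIdeal c0_0 c0_D c0_Z c0_Ml c0_Mr c0_star c0_closed.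

(* A_oo = l^oo(nat, A) / c_0(nat, A) *)
Definition seq_alg := quot_alg c0.

Fact const_seq_bounded (a : A) : nbounded (fun _ : nat => a).
Proof. by apply/asboolP; exists (nrm a). Qed.
Definition const_seq (a : A) : linfty nat A := Linfty (const_seq_bounded a).

Definition seq_embed (a : A) : seq_alg := quot_pi c0 (const_seq a).

Lemma seq_embed_star a : seq_embed (star a) = star (seq_embed a).
Proof.
by rewrite -quot_pi_star; congr quot_pi; apply: linfty_ext.
Qed.

End SequenceAlgebra.

Record cstar_subalg (R : realType) (A : cstarAlgType R) := CstarSubalg {
  csa_subalg :> star_subalg A;
  csa_closed : closed (csa_subalg : set A)
}.

Definition separable_subset (T : topologicalType) (D : set T) : Prop :=
  exists S : set T, [/\ countable S, S `<=` D & D `<=` closure S].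

Section CentralSequenceAlgebra.
Variables (R : realType) (A : cstarAlgType R) (D : cstar_subalg A).
Implicit Types x y : seq_alg A.

(* A_oo \cap D', where D sits in A_oo as the constant sequences *)
Definition commutant_set : set (seq_alg A) :=
  [set x | forall d, ssa_set D d -> x ** seq_embed d = seq_embed d ** x].

Fact commutant0 : commutant_set 0.
Proof. by move=> d _; rewrite amul0r amulr0. Qed.
Fact commutantD x y :
  commutant_set x -> commutant_set y -> commutant_set (x + y).
Proof. by move=> xD yD d Dd; rewrite amulDl amulDr xD// yD. Qed.
Fact commutantZ (c : R[i]) x : commutant_set x -> commutant_set (c *: x).
Proof. by move=> xD d Dd; rewrite amulZl amulZr xD. Qed.
Fact commutantM x y :
  commutant_set x -> commutant_set y -> commutant_set (x ** y).
Proof. by move=> xD yD d Dd; rewrite -amulA yD// amulA xD// amulA. Qed.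
Fact commutant_star x : commutant_set x -> commutant_set (star x).
Proof.
move=> xD d Dd; rewrite -[seq_embed d]starK -!starM -seq_embed_star xD//.
exact: ssa_star.
Qed.

Definition commutant : star_subalg (seq_alg A) :=
  StarSubalg commutant0 commutantD commutantZ commutantM commutant_star.

Definition annihilator_set : set (ssa_type commutant) :=
  [set x | forall d, ssa_set D d ->
     ssa_val x ** seq_embed d = 0 /\ seq_embed d ** ssa_val x = 0].

Fact annihilator0 : annihilator_set 0.
Proof. by move=> d _; rewrite ssa_val0 amul0r amulr0. Qed.
Fact annihilatorD (x y : ssa_type commutant) :
  annihilator_set x -> annihilator_set y -> annihilator_set (x + y).
Proof.
move=> xD yD d Dd; have [x1 x2] := xD _ Dd; have [y1 y2] := yD _ Dd.
by rewrite ssa_valD amulDl amulDr x1 x2 y1 y2 addr0.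
Qed.
Fact annihilatorZ (c : R[i]) (x : ssa_type commutant) :
  annihilator_set x -> annihilator_set (c *: x).
Proof.
move=> xD d Dd; have [x1 x2] := xD _ Dd.
by rewrite ssa_valZ amulZl amulZr x1 x2 scaler0.
Qed.
Fact annihilatorMl (x y : ssa_type commutant) :
  annihilator_set y -> annihilator_set (x ** y).
Proof.
move=> yD d Dd; have [y1 y2] := yD _ Dd; rewrite ssa_valM.
by rewrite -amulA y1 amulA -(ssa_valP x)// -amulA y2 !amulr0.
Qed.
Fact annihilatorMr (x y : ssa_type commutant) :
  annihilator_set x -> annihilator_set (x ** y).
Proof.
move=> xD d Dd; have [x1 x2] := xD _ Dd; rewrite ssa_valM.
by rewrite amulA x2 -amulA (ssa_valP y)// amulA x1 !amul0r.
Qed.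
Fact annihilator_star (x : ssa_type commutant) :
  annihilator_set x -> annihilator_set (star x).
Proof.
move=> xD d Dd; have [x1 x2] := xD _ (ssa_star Dd).
rewrite ssa_val_star -[seq_embed d]starK -!starM -seq_embed_star x1 x2.
by rewrite star0.
Qed.
Fact annihilator_closed : closed annihilator_set.
Proof.
apply: nrm_closed => x xc d Dd.
split; apply: (nrm_small (K := nrm (seq_embed d))) => e e0;
    have [y /(_ _ Dd)[y1 y2] xy] := xc _ e0.
- rewrite -[_ ** _]subr0 -y1 -amulBl (le_trans (nrm_amul _ _))// mulrC.
  by rewrite ler_wpM2l ?nrm_ge0// ltW.
- rewrite -[_ ** _]subr0 -y2 -amulBr (le_trans (nrm_amul _ _))//.
  by rewrite ler_wpM2l ?nrm_ge0// ltW.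
Qed.

Definition annihilator : star_ideal (ssa_type commutant) :=
  StarIdeal annihilator0 annihilatorD annihilatorZ annihilatorMl
    annihilatorMr annihilator_star annihilator_closed.

(* F(D, A) = (A_oo \cap D') / Ann(D, A_oo); Ann(D, A_oo) is contained in the
   commutant, so that nothing is lost by taking it inside A_oo \cap D'. *)
Definition central_alg := quot_alg annihilator.

End CentralSequenceAlgebra.

(* A group homomorphism from G to the *-automorphisms of A; bijectivity of each
   act g follows from act1 and actM. *)
Record cstar_action (R : realType) (G : groupType) (A : cstarAlgType R) :=
  CstarAction {
  act :> G -> A -> A;
  act_linear : forall g, linear (act g);
  act_amul : forall g, {morph act g : x y / x ** y};
  act_star : forall g, {morph act g : x / star x};
  act1 : forall x, act 1%g x = x;
  actM : forall g h x, act (g * h)%g x = act g (act h x)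
}.

Section InducedAction.
Variables (R : realType) (G : groupType) (A : cstarAlgType R).
Variable alpha : cstar_action G A.
Implicit Types (t : G) (x y : linfty nat A).

Fact linfty_act_bounded t x : nbounded (fun n => alpha t (x n)).
Proof.
apply/asboolP; exists (linfty_nrm x) => n; apply: le_trans (nrm_le_linfty x n).
apply: star_hom_contractive; [exact: act_linear|exact: act_amul|exact: act_star].
Qed.
Definition linfty_act t x : linfty nat A := Linfty (linfty_act_bounded t x).

Definition seq_act t (x : seq_alg A) : seq_alg A :=
  quot_pi (c0 A) (linfty_act t (quot_repr x)).

Let actB t a b : alpha t (a - b) = alpha t a - alpha t b.
Proof.
by have := act_linear alpha t (-1) b a; rewrite !scaleN1r ![- _ + _]addrC.
Qed.

Lemma seq_actE t x :
  seq_act t (quot_pi (c0 A) x) = quot_pi (c0 A) (linfty_act t x).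
Proof.
apply/quot_piP; have := @quot_reprP _ _ (c0 A) x; set y := quot_repr _ => xy.
apply: nrm_cvg => e e0; have := cvg_nrm xy e0; apply: filterS => n.
rewrite !sub0r !nrmN; apply: le_lt_trans.
have -> : (linfty_act t y - linfty_act t x) n = alpha t ((y - x) n).
  by rewrite /= actB.
apply: star_hom_contractive; [exact: act_linear|exact: act_amul|exact: act_star].
Qed.

Lemma seq_actM t : {morph seq_act t : x y / x ** y}.
Proof.
move=> x y; rewrite -[x]quot_reprK -[y]quot_reprK -quot_piM !seq_actE -quot_piM.
by congr quot_pi; apply: linfty_ext => n; exact: act_amul.
Qed.

Lemma seq_actB t : {morph seq_act t : x y / x - y}.
Proof.
move=> x y; rewrite -[x]quot_reprK -[y]quot_reprK -quot_piB !seq_actE -quot_piB.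
by congr quot_pi; apply: linfty_ext => n; exact: actB.
Qed.

Lemma seq_act0 t : seq_act t 0 = 0.
Proof. by have := seq_actB t 0 0; rewrite !subrr. Qed.

Lemma seq_act_embed t a : seq_act t (seq_embed a) = seq_embed (alpha t a).
Proof. by rewrite seq_actE; congr quot_pi; apply: linfty_ext. Qed.

Definition act_invariant (D : set A) : Prop :=
  forall t a, D a -> D (alpha t a).

Variables (D : cstar_subalg A) (Dinv : act_invariant D).

Fact commutant_act_subproof t (x : ssa_type (commutant D)) :
  ssa_set (commutant D) (seq_act t (ssa_val x)).
Proof.
move=> d Dd; have xD : commutant_set D (ssa_val x) := ssa_valP x.
have -> : seq_embed d = seq_act t (seq_embed (alpha t^-1%g d)).
  by rewrite seq_act_embed -actM mulgV act1.
by rewrite -!seq_actM xD//; exact: Dinv.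
Qed.
Definition commutant_act t (x : ssa_type (commutant D)) :
    ssa_type (commutant D) :=
  to_ssa (commutant_act_subproof t x).

Definition central_act t (x : central_alg D) : central_alg D :=
  quot_pi (annihilator D) (commutant_act t (quot_repr x)).

Lemma central_actE t (x : ssa_type (commutant D)) :
  central_act t (quot_pi (annihilator D) x) =
  quot_pi (annihilator D) (commutant_act t x).
Proof.
apply/quot_piP; have := @quot_reprP _ _ (annihilator D) x.
set y := quot_repr _ => yx.
change (annihilator_set (commutant_act t y - commutant_act t x)) => d Dd.
have -> : seq_embed d = seq_act t (seq_embed (alpha t^-1%g d)).
  by rewrite seq_act_embed -actM mulgV act1.
have -> : ssa_val (commutant_act t y - commutant_act t x) =
    seq_act t (ssa_val (y - x)) by rewrite /= seq_actB.
have [h1 h2] := yx _ (Dinv t^-1%g Dd).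
by rewrite -!seq_actM h1 h2 seq_act0.
Qed.

End InducedAction.

Section RestrictedAction.
Variables (R : realType) (G : groupType) (A : cstarAlgType R).
Variables (alpha : cstar_action G A) (H : groupClosed G).

Definition restrict_act (h : subgroup_type H) : A -> A := alpha (sg_val h).
Fact restrict_act1 (x : A) : restrict_act 1%g x = x. Proof. exact: act1. Qed.
Fact restrict_actM (g h : subgroup_type H) (x : A) : 
  restrict_act (g * h)%g x = restrict_act g (restrict_act h x).
Proof. exact: actM. Qed.

Definition restrict_action : cstar_action (subgroup_type H) A :=
  @CstarAction R _ A restrict_act
    (fun h => act_linear alpha (sg_val h))
    (fun h => act_amul alpha (sg_val h)) (fun h => act_star alpha (sg_val h))
    restrict_act1 restrict_actM.

End RestrictedAction.

Section OrderZeroMaps.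
Variables (R : realType) (B C : nstarAlgType R).
Implicit Types phi : B -> C.

Definition orthogonal (E : nstarAlgType R) (a b : E) : Prop :=
  [/\ a ** b = 0, b ** a = 0, star a ** b = 0 & star b ** a = 0].

Definition order_zero phi : Prop :=
  forall a b, orthogonal a b -> orthogonal (phi a) (phi b).

(* Positivity in M_n(E): being of the form (star y) y, where star y is the
   entrywise star of the transpose of y. *)
Definition mx_positive (E : nstarAlgType R) n (x : 'M[E]_n) : Prop :=
  exists y : 'M[E]_n, x = \matrix_(i, j) \sum_k star (y k i) ** y k j.

Definition completely_positive phi : Prop :=
  forall n (x : 'M[B]_n), mx_positive x -> mx_positive (map_mx phi x).

Definition ccp phi : Prop :=
  [/\ linear phi, completely_positive phi & forall x, `|phi x| <= `|x|].

End OrderZeroMaps.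

Definition is_identity (R : realType) (E : nstarAlgType R) (u : E) : Prop :=
  forall x, u ** x = x /\ x ** u = x.

(* For L of finite index, G/L is a finite discrete space, so that C(G/L) is the
   algebra of all (bounded) functions on it. *)
Section CosetFunctions.
Variables (R : realType) (G : groupType) (L : groupClosed G).

Definition coset_alg := linfty (coset_space L) R[i]^o.

Fact coset_one_bounded : nbounded (fun _ : coset_space L => 1 : R[i]^o).
Proof. by apply/asboolP; exists (nrm (1 : R[i]^o)). Qed.
Definition coset_one : coset_alg := Linfty coset_one_bounded.

Fact coset_shift_bounded (t : G) (f : coset_alg) :
  nbounded (fun c => f (coset_act t^-1%g c)).
Proof.
by apply/asboolP; exists (linfty_nrm f) => c; exact: nrm_le_linfty.
Qed.
Definition coset_shift (t : G) (f : coset_alg) : coset_alg :=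
  Linfty (coset_shift_bounded t f).

End CosetFunctions.

Section RokhlinDimension.
Variables (R : realType) (G : groupType) (A : cstarAlgType R).
Variable alpha : cstar_action G A.

Definition rokhlin_towers (L : groupClosed G) (D : cstar_subalg A)
    (Dinv : act_invariant alpha D) (d : nat)
    (phi : 'I_d.+1 -> coset_alg R L -> central_alg D) : Prop :=
  [/\ forall l, ccp (phi l),
      forall l, order_zero (phi l),
      forall l t f, phi l (coset_shift t f) = central_act Dinv t (phi l f)
    & is_identity (\sum_l phi l (coset_one R L))].

Definition commuting_ranges (B C : nstarAlgType R) d (phi : 'I_d -> B -> C) :=
  forall k l, k != l -> forall f g,
    phi k f ** phi l g = phi l g ** phi k f.

Definition has_rokhlin_dim_le (L : groupClosed G) (d : nat) : Prop :=
  forall (D : cstar_subalg A) (Dinv : act_invariant alpha D),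
    separable_subset (D : set A) ->
    exists phi, @rokhlin_towers L D Dinv d phi.

Definition has_rokhlin_dim_comm_le (L : groupClosed G) (d : nat) : Prop :=
  forall (D : cstar_subalg A) (Dinv : act_invariant alpha D),
    separable_subset (D : set A) ->
    exists phi, @rokhlin_towers L D Dinv d phi /\ commuting_ranges phi.

(* Rokhlin dimensions take their values in nat extended by +oo, seen inside
   \bar R: the infimum of a nonempty set of naturals is its least element and
   that of the empty set is +oo. *)
Definition rokhlin_dim_at (L : groupClosed G) : \bar R :=
  ereal_inf [set (d%:R)%:E | d in has_rokhlin_dim_le L].
Definition rokhlin_dim_comm_at (L : groupClosed G) : \bar R :=
  ereal_inf [set (d%:R)%:E | d in has_rokhlin_dim_comm_le L].

Definition rokhlin_dim : \bar R :=
  ereal_sup [set r | exists L : groupClosed G,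
    finite_index L /\ r = rokhlin_dim_at L].
Definition rokhlin_dim_comm : \bar R :=
  ereal_sup [set r | exists L : groupClosed G,
    finite_index L /\ r = rokhlin_dim_comm_at L].

End RokhlinDimension.

(* Main.v *)
(* Given a finite index subgroup M of H, pull it back along the retraction
   K -> H and let N be the normal core in G of the resulting subgroup. Since N is
   normal, H-equivariance on cosets of K suffices to extend K/N -> H/M to an
   H-equivariant map G/N -> H/M, that is, a unital H-equivariant *-homomorphism
   C(H/M) -> C(G/N). As G is countable, a separable H-invariant D sits in a
   separable G-invariant E, and the inclusion of A_oo \cap E' in A_oo \cap D' yields
   an H-equivariant *-homomorphism F(E, A) -> F(D, A), unital because E has a
   sequential approximate unit. Rokhlin towers for (N, E) are sandwiched between
   these two homomorphisms to give towers for (M, D). *)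
Require Import Defs.
From HB Require Import structures.
From mathcomp Require Import all_boot all_order all_algebra.
From mathcomp Require Import all_classical all_reals all_analysis.
From mathcomp Require Import complex lra.
Set Implicit Arguments.
Unset Strict Implicit.
Unset Printing Implicit Defensive.
Import Order.TTheory GRing.Theory Num.Theory.
Import numFieldNormedType.Exports.
Local Open Scope classical_set_scope.
Local Open Scope complex_scope.
Local Open Scope ring_scope.

(** * Subgroups of finite index and maps between coset spaces *)

Lemma groupClosed_of (G : groupType) (P : G -> Prop) :
  P 1%g -> (forall x y, P x -> P y -> P (x * y)%g) ->
  (forall x, P x -> P x^-1%g) ->
  exists S : groupClosed G, forall x, x \in S <-> P x.
Proof.
move=> P1 PM PV; pose S : {pred G} := fun x => `[< P x >].
have SM : mulg_closed S.
  by move=> x y /asboolP Px /asboolP Py; apply/asboolP; exact: PM.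
have S1 : 1%g \in S by apply/asboolP.
have SV : invg_closed S by move=> x /asboolP Px; apply/asboolP; exact: PV.
pose iM := isMulClosed.Build G S SM.
pose i1 := isMul1Closed.Build G S S1.
pose iV := isInvClosed.Build G S SV.
pose T : groupClosed G := HB.pack S iM i1 iV.
by exists T => x; split=> [/asboolP|Px]; [|apply/asboolP].
Qed.

Section CosetAction.
Variables (G : groupType) (L : groupClosed G).

Lemma coset_reprK (c : coset_space L) : coset_pi L (repr c) = c.
Proof. exact: reprK. Qed.

Lemma coset_act1 (c : coset_space L) : coset_act 1%g c = c.
Proof. by rewrite -[c]coset_reprK coset_actE mul1g. Qed.

Lemma coset_actM x y (c : coset_space L) :
  coset_act (x * y)%g c = coset_act x (coset_act y c).
Proof. by rewrite -[c]coset_reprK !coset_actE mulgA. Qed.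

(** Evaluating [f] at chosen representatives embeds the coset space in [T], so [f] need not be
    constant on cosets. *)
Lemma finite_index_inj (T : Type) (f : G -> T) :
  finite_set [set: T] ->
  (forall x y, f x = f y -> (x^-1 * y)%g \in L) -> finite_index L.
Proof.
move=> Tfin fL; pose h (c : coset_space L) := f (repr c).
have hI : {in [set: coset_space L] &, injective h}.
  by move=> c d _ _ /fL/coset_piP; rewrite !coset_reprK.
rewrite /finite_index -(eq_finite_set (inj_card_eq hI)).
exact: sub_finite_set Tfin.
Qed.

End CosetAction.

(** [N] is the kernel of the action on [G/L]: elements permuting the finitely many cosets alike
    differ by an element of [N]. *)
Lemma normal_core_finite_index (G : groupType) (L : groupClosed G) :
  finite_index L ->
  exists N : groupClosed G, finite_index N /\
    forall n g, n \in N -> (n ^ g)%g \in L.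
Proof.
move=> Lfin.
have [||| N NP] := @groupClosed_of G
  (fun n => forall c : coset_space L, coset_act n c = c).
- exact: coset_act1.
- by move=> x y xc yc c; rewrite coset_actM yc xc.
- by move=> x xc c; rewrite -[in LHS](xc c) -coset_actM mulVg coset_act1.
exists N; split; last first.
  move=> n g /NP/(_ (coset_pi L g)); rewrite coset_actE => /esym/coset_piP.
  by rewrite /conjg mulgA.
have /finite_seqP[s sE] := Lfin.
have sP c : c \in s by have : [set: coset_space L] c by []; rewrite sE.
(* [f g] tabulates the permutation by positions in [s]; the successor in the codomain is what
   [inord] requires. *)
pose f g : {ffun 'I_(size s) -> 'I_(size s).+1} :=
  [ffun i : 'I_(size s) =>
    inord (index (coset_act g (nth (coset_pi L 1%g) s i)) s)].
apply: (@finite_index_inj _ _ _ f finite_finset) => x y fxy.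
apply/NP => c; rewrite coset_actM.
suff -> : coset_act y c = coset_act x c by rewrite -coset_actM mulVg coset_act1.
have ci : (index c s < size s)%N by rewrite index_mem.
have := congr1 (fun h : {ffun _ -> _} => val (h (Ordinal ci))) fxy.
rewrite !ffunE /= nth_index// !inordK ?ltnS ?index_size// => /esym ixy.
by rewrite -[LHS](nth_index c (sP _)) ixy nth_index.
Qed.

(* With [L] the preimage of [M] under the retraction [rho] of a finite index
   subgroup [K] onto [H], and [N] the normal core of [L], write [x] as [k r]
   with [k] in [K] and [r] the chosen representative of [K x]; then [x N] is
   sent to [rho k M]. Normality of [N] makes this well defined. *)
Lemma virtual_retract_coset_map (G : groupType) (H : groupClosed G)
    (M : groupClosed (subgroup_type H)) :
  virtual_retract H -> finite_index M ->
  exists N : groupClosed G, finite_index N /\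
    exists f : coset_space N -> coset_space M,
      forall (h : subgroup_type H) c,
        f (coset_act (sg_val h) c) = coset_act h (f c).
Proof.
move=> [K [Kfin [HK [rho [rhoH rhoM rhoid]]]]] Mfin.
(* The default 1 is taken only where [rho] leaves [H], hence never on [K]. *)
pose r (x : G) : subgroup_type H := insubd 1%g (rho x).
have rE x : x \in K -> sg_val (r x) = rho x.
  by move=> /rhoH xH; rewrite /r; exact: insubdK.
have sg_inj (a b : subgroup_type H) : sg_val a = sg_val b -> a = b.
  exact: val_inj.
have rM x y : x \in K -> y \in K -> r (x * y)%g = (r x * r y)%g.
  move=> xK yK; apply: sg_inj; rewrite rE ?gpredM// rhoM//.
  by rewrite -(rE x)// -(rE y).
have rh h : r (sg_val h) = h.
  case: h => h hH; apply: sg_inj; rewrite rE /=; last exact: HK.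
  exact: rhoid.
have rV x : x \in K -> r x^-1%g = (r x)^-1%g.
  move=> xK; apply: (mulgI (r x)); rewrite mulgV -rM ?gpredVr// mulgV.
  exact: rh 1%g.
have [||| L LP] := @groupClosed_of G (fun x => x \in K /\ r x \in M).
- by split; [exact: gpred1|rewrite (rh 1%g) gpred1].
- by move=> x y [xK xM] [yK yM]; rewrite rM// !gpredM.
- by move=> x [xK xM]; rewrite rV// !gpredVr.
have kK x : ((repr (coset_pi K x))^-1 * x)%g \in K.
  by apply/coset_piP; rewrite coset_reprK.
have Lfin : finite_index L.
  (* This pair separates the cosets of [L], whence [[G : L] <= [G : K] [H : M]]. *)
  pose f x := (coset_pi K x, coset_pi M (r ((repr (coset_pi K x))^-1 * x)%g)).
  apply: (@finite_index_inj _ _ _ f).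
    by rewrite -setXTT; exact: finite_setX.
  move=> x y [xyK]; rewrite xyK; have := kK x; have := kK y; rewrite xyK.
  set t := repr _ => yK xK /coset_piP; rewrite -rV// -rM ?gpredVr//.
  by rewrite invgM invgK mulgA mulgK => xyM; apply/LP; split => //; apply/coset_piP.
have [N [Nfin NL]] := normal_core_finite_index Lfin.
exists N; split => //.
(* Left translation by [H] preserves the right cosets [K x]. They are read off the left cosets of
   [x^-1], and [(q x)^-1] represents [K x]. *)
pose q x := repr (coset_pi K x^-1%g).
have qK x : (x * q x)%g \in K.
  by have /gpredVr := kK x^-1%g; rewrite invgM !invgK.
pose f0 x := coset_pi M (r (x * q x)%g).
have f0N x n : n \in N -> f0 (x * n)%g = f0 x.
  move=> nN.
  (* As [x n x^-1] lies in [K], right cosets agree; the conjugate of [n] by [q x] then shows that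
     the values of [r] agree modulo [M]. *)
  have /LP[nK _] := NL _ x^-1%g nN.
  have qE : q (x * n)%g = q x.
    rewrite /q; congr repr; apply/coset_piP; rewrite invgM !invgM !invgK.
    by move: nK; rewrite /conjg invgK mulgA.
  have xnK : (x * n * q x)%g \in K by rewrite -qE.
  rewrite /f0 qE; apply/esym/coset_piP; rewrite -rV// -rM ?gpredVr//.
  have /LP[_] := NL _ (q x) nN.
  by rewrite /conjg invgM !mulgA mulgVK.
have f0h (h : subgroup_type H) x :
    f0 (sg_val h * x)%g = coset_act h (f0 x).
  have hK : sg_val h \in K by apply: HK; case: h.
  have qE : q (sg_val h * x)%g = q x.
    rewrite /q; congr repr; apply/coset_piP.
    by rewrite !invgM !invgK mulgK.
  by rewrite /f0 qE coset_actE -mulgA rM// rh.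
exists (fun c => f0 (repr c)) => h c.
rewrite -f0h /coset_act; set y := (_ * _)%g.
rewrite -[RHS](f0N _ (y^-1 * repr (coset_pi N y))%g) ?mulgA ?mulgV ?mul1g//.
by apply/coset_piP; rewrite coset_reprK.
Qed.

(** * Norm closures and approximate units *)

Lemma closure_nrmP (R : realType) (V : normedModType R[i]) (S : set V) x :
  closure S x <-> forall e : R, 0 < e -> exists2 y, S y & nrm (x - y) < e.
Proof.
split=> [Sx e e0|Sx]; last first.
  move=> U; rewrite -nbhs_ballE => -[e /= e0 eU].
  have e0' : 0 < complex.Re e by rewrite -ltcR RRe_real// gtr0_real.
  have [y Sy xy] := Sx _ e0'; exists y; split => //.
  apply: eU; rewrite -ball_normE /ball_ /= nrmE.
  by rewrite -(RRe_real (gtr0_real e0)) ltcR.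
have e0' : 0 < e%:C by rewrite ltcR.
have [y [Sy]] := Sx _ (nbhsx_ballx x e%:C e0').
by rewrite -ball_normE /ball_ /= nrmE ltcR => xy; exists y.
Qed.

Lemma countable_sub_range (T : choiceType) (x0 : T) (S : set T) :
  countable S -> exists s : nat -> T, S `<=` range s.
Proof.
move=> /countable_injP[f fI].
pose s n := xget x0 [set x | S x /\ f x = n].
exists s => x Sx; exists (f x) => //.
have [Sy fy] := xgetPex x0 (ex_intro (fun y => S y /\ f y = f x) x (conj Sx erefl)).
by apply: fI => //; exact/mem_set.
Qed.

Section ApproximateUnits.
Variables (R : realType) (A : cstarAlgType R).
Implicit Types d e f u x y : A.

(** Unit-free form of: right multiplication by [1 - e] is contractive on [A]. *)
Definition co_contractive e := forall x, nrm (x - x ** e) <= nrm x.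

Lemma co_contractive0 : co_contractive 0.
Proof. by move=> x; rewrite amulr0 subr0. Qed.

(** This is [1 - (e + f - e f) = (1 - e)(1 - f)], so the quasi-product on the left composes two
    contractions. *)
Lemma subr_quasimul x e f :
  x - x ** (e + f - e ** f) = (x - x ** e) - (x - x ** e) ** f.
Proof.
by rewrite amulBr amulDr amulBl amulA !opprB !opprD addrA addrACA !addrA.
Qed.

Lemma co_contractive_quasimul e f :
  co_contractive e -> co_contractive f -> co_contractive (e + f - e ** f).
Proof. by move=> he hf x; rewrite subr_quasimul; apply: le_trans (he x). Qed.

(** The C*-identity, with the hypothesis at [star e], gives [|e|^2 <= 2 |e|]. Approximate units
    built this way are thus bounded sequences. *)
Lemma co_contractive_nrm e : co_contractive e -> nrm e <= 2.
Proof.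
move=> he; have [->|e0] := eqVneq (nrm e) 0; first by rewrite ler0n.
have ep : 0 < nrm e by rewrite lt_neqAle eq_sym e0 nrm_ge0.
have h1 := he (star e); have h2 := nrmD (star e) (- (star e - star e ** e)).
rewrite subKr nrmN nrm_cstar nrm_star in h1 h2.
rewrite -(ler_pM2r ep) -expr2; lra.
Qed.

(* With [2 c = b^2 + c^2], i.e. [b^2 + (1 - c)^2 = 1], the elements
   [(1 - c) +- i b] of the unitization are unitary, and [1 - c] is their average. *)
Lemma co_contractive_sqr b : star b = b -> nrm b < 1 -> co_contractive (b ** b).
Proof.
move=> bs b1; have [c [cs cb cE]] := cstar_sqrt_exists bs b1.
pose w (s : R[i]) a := s *: (b ** a) + (a - c ** a).
have nw (s : R[i]) a : s^* = - s -> s ^+ 2 = -1 -> nrm (w s a) = nrm a.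
  move=> sc s2; apply: (@pexpIrn _ 2) => //; try exact: nrm_ge0.
  rewrite -!nrm_cstar; congr (nrm _); rewrite /w.
  move qE : (a - c ** a) => q; rewrite starD starZ starM bs sc amulDl !amulDr.
  rewrite !amulZl !amulZr scalerA mulNr -expr2 s2 opprK scale1r scaleNr.
  have qb : star a ** b ** q = star q ** (b ** a).
    rewrite -qE starB starM cs amulBl amulBr !amulA.
    by rewrite -[_ ** b ** c]amulA -cb !amulA.
  rewrite qb addrA subrK {qb} -qE starB starM cs !amulBr !amulBl !amulA.
  have -> : star a ** b ** b ** a =
      star a ** c ** a + star a ** c ** a - star a ** c ** c ** a.
    apply/esym/eqP; rewrite subr_eq -amulDl -amulDr cE amulDr amulDl.
    by rewrite !amulA.
  set X := star a ** a; set Y := star a ** c ** a.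
  set Z := star a ** c ** c ** a.
  by rewrite -[X - Y - _]addrA -opprD [in X - _]addrA addrC subrK.
have cc : co_contractive c.
  move=> x; rewrite -nrm_star starB starM cs -[leRHS]nrm_star.
  move: (star x) => {}x.
  have : nrm ((2 : R[i]) *: (x - c ** x)) <= nrm (w 'i x) + nrm (w (- 'i) x).
    apply: le_trans (nrmD _ _); rewrite /w addrACA -scalerDl subrr scale0r.
    by rewrite add0r scaler_nat mulr2n.
  rewrite nrmZ !nw ?rmorphN /= ?conjCi ?sqrrN ?sqrCi//.
  have -> : (2 : R[i]) = (2 : R)%:C by rewrite rmorph_nat.
  by rewrite nrm_real ger0_norm//; lra.
(* That is, [b^2 = 1 - (1 - c)^2], the quasi-product of [c] with itself. *)
have -> : b ** b = c + c - c ** c by rewrite cE addrK.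
exact: co_contractive_quasimul.
Qed.

(** By the C*-identity the left side is the norm of [star (1 - u) ** star d ** d ** (1 - u)];
    contractivity drops the right factor, and the rest is starred. *)
Lemma sqr_nrm_subr_amul d u : co_contractive u ->
  nrm (d - d ** u) ^+ 2 <= nrm (star d ** d - star d ** d ** u).
Proof.
move=> hu; rewrite -nrm_cstar.
have -> : star (d - d ** u) ** (d - d ** u) =
    star (d - d ** u) ** d - star (d - d ** u) ** d ** u.
  by rewrite amulBr amulA.
apply: le_trans (hu (star (d - d ** u) ** d)) _.
by rewrite -[leLHS]nrm_star starM starK amulBr amulA.
Qed.

(* [1 - u] is the Cesaro mean of [(1 - e)^k] for [k < n]; with
   [p k = 1 - (1 - e)^k] this gives [e (1 - u) = p n / n]. *)
Lemma co_contractive_subr_small e (r : R) : co_contractive e -> 0 < r ->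
  exists2 u, co_contractive u & nrm (e - e ** u) < r.
Proof.
move=> he r0; pose p := fix p n := if n is m.+1 then e + p m - e ** p m else 0.
have hp n : co_contractive (p n).
  elim: n => [|n IH]; first exact: co_contractive0.
  exact: co_contractive_quasimul.
pose m n := \sum_(k < n) p k.
have mE n : n%:R *: e - e ** m n = p n.
  elim: n => [|n IH]; first by rewrite /m big_ord0 amulr0 scale0r subr0.
  rewrite /m big_ord_recr/= amulDr -[n.+1%:R]natr1 scalerDl scale1r opprD.
  by rewrite addrACA -/(m n) IH addrA [p n + e]addrC.
have hm n x : nrm (n%:R *: x - x ** m n) <= n%:R * nrm x.
  elim: n => [|n IH].
    by rewrite /m big_ord0 amulr0 scale0r subr0 mul0r nrm0.
  rewrite /m big_ord_recr/= amulDr -[in leLHS]natr1 scalerDl scale1r opprD.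
  rewrite addrACA -/(m n) -natr1 mulrDl mul1r.
  by apply: le_trans (nrmD _ _) _; apply: lerD => //; exact: hp.
pose n := (Num.truncn (2 / r)).+1.
have n0 : 0 < n%:R :> R by rewrite ltr0n.
have nC : (n%:R : R[i]) != 0 by rewrite pnatr_eq0.
have nV : nrm (n%:R^-1 : R[i]) = n%:R^-1.
  have -> : (n%:R^-1 : R[i]) = (n%:R^-1 : R)%:C by rewrite fmorphV rmorph_nat.
  by rewrite nrm_real ger0_norm// invr_ge0 ler0n.
have uE x : x - x ** (n%:R^-1 *: m n) = n%:R^-1 *: (n%:R *: x - x ** m n).
  by rewrite amulZr scalerBr scalerA mulVf// scale1r.
exists (n%:R^-1 *: m n) => [x|]; rewrite uE nrmZ nV.
  by rewrite mulrC ler_pdivrMr// mulrC.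
rewrite mE mulrC ltr_pdivrMr// (le_lt_trans (co_contractive_nrm (hp n)))//.
by rewrite mulrC -ltr_pdivrMr// /n truncnS_gt.
Qed.

Lemma approximate_right_unit d (r : R) : 0 < r ->
  exists2 u, co_contractive u & nrm (d - d ** u) < r.
Proof.
move=> r0; pose b := star d ** d.
have bs : star b = b by rewrite /b starM starK.
pose k := nrm b + 1; have k0 : 0 < k by rewrite ltr_wpDl ?nrm_ge0.
have nk : nrm ((k^-1)%:C : R[i]) = k^-1.
  by rewrite nrm_real ger0_norm// invr_ge0 ltW.
pose b' := (k^-1)%:C *: b.
have b's : star b' = b' by rewrite /b' starZ bs conj_Creal// complex_real.
have b'1 : nrm b' < 1.
  by rewrite /b' nrmZ nk mulrC ltr_pdivrMr// mul1r ltrDl.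
have kC : (k%:C : R[i]) != 0 by rewrite (inj_eq (@complexI R) k 0) gt_eqF.
(* [k] undoes the scaling of [b], [r ^+ 2] pays for passing from [d] to [star d ** d], and the outer
   square for passing from [b'] to its square. *)
have s0 : 0 < (r ^+ 2 / k) ^+ 2 by rewrite exprn_gt0 ?divr_gt0 ?exprn_gt0.
have [u hu us] := co_contractive_subr_small (co_contractive_sqr b's b'1) s0.
exists u => //.
have h1 : nrm (b' - b' ** u) < r ^+ 2 / k.
  rewrite -(@ltr_pXn2r _ 2) ?nnegrE ?nrm_ge0 ?divr_ge0 ?exprn_ge0 ?(ltW k0)//.
    apply: le_lt_trans us; have := sqr_nrm_subr_amul b' hu.
    by rewrite b's.
  exact: ltW.
rewrite -(@ltr_pXn2r _ 2) ?nnegrE ?nrm_ge0 ?(ltW r0)//.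
apply: le_lt_trans (sqr_nrm_subr_amul d hu) _; rewrite -/b.
move: h1; rewrite /b' amulZl -scalerBr nrmZ nk mulrC.
by rewrite ltr_pM2r// invr_gt0.
Qed.

(** A unit [v] for the residue [d - d ** u] is joined to [u] by the quasi-product; co-contractivity
    of [v] keeps the earlier estimates. *)
Lemma approximate_right_unit_seq (s : seq A) (r : R) : 0 < r ->
  exists2 u, co_contractive u & forall d, d \in s -> nrm (d - d ** u) < r.
Proof.
move=> r0; elim: s => [|d s [u hu us]]; first by exists 0; first exact: co_contractive0.
have [v hv vs] := approximate_right_unit (d - d ** u) r0.
exists (u + v - u ** v) => [|y]; first exact: co_contractive_quasimul.
rewrite inE subr_quasimul => /predU1P[->//|/us].
by apply: le_lt_trans.
Qed.

(** The [n]-th term fixes the first [n + 1] points of a sequence through a dense set up to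
    [1 / (n + 1)]; co-contractivity extends this to all of [D]. *)
Lemma separable_approximate_right_unit (D : set A) : separable_subset D ->
  exists v : seq_alg A, forall d, D d -> seq_embed d ** v = seq_embed d.
Proof.
move=> [S [Sc _ DS]]; have [s Ss] := countable_sub_range (0 : A) Sc.
have rV n : (0 : R) < n.+1%:R^-1 by rewrite invr_gt0 ltr0n.
have /choice[e eP] : forall n, exists u, co_contractive u /\
    forall d, d \in map s (iota 0 n.+1) -> nrm (d - d ** u) < n.+1%:R^-1.
  by move=> n; have [u] := approximate_right_unit_seq (map s (iota 0 n.+1)) (rV n);
    exists u.
have eb : nbounded e.
  by apply/asboolP; exists 2 => n; exact: co_contractive_nrm (eP n).1.
exists (quot_pi (c0 A) (Linfty eb)) => d Dd.
rewrite /seq_embed -quot_piM; apply/esym/quot_piP; apply: nrm_cvg => r r0.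
have r2 : 0 < r / 2 by rewrite divr_gt0.
have /closure_nrmP/(_ _ r2)[y /Ss[k _ <-] dk] := DS _ Dd.
exists (maxn k (Num.truncn (r / 2)^-1)) => // n /=; rewrite geq_max => /andP[kn rn].
rewrite sub0r nrmN /=; have [en es] := eP n.
have skn : nrm (s k - s k ** e n) < r / 2.
  apply: lt_trans (es (s k) _) _.
    by apply: map_f; rewrite mem_iota /= add0n ltnS.
  rewrite invf_plt ?posrE ?ltr0n//; apply: lt_le_trans (truncnS_gt _) _.
  by rewrite ler_nat ltnS.
rewrite -[ltLHS]/(nrm (d - d ** e n)).
rewrite -[in ltLHS](subrK (s k) d) amulDl opprD addrACA.
apply: le_lt_trans (nrmD _ _) _; rewrite [r]splitr ltrD//.
exact: le_lt_trans (en _) dk.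
Qed.
End ApproximateUnits.

(** * Separable invariant C*-subalgebras *)

Lemma countable_setU (T : Type) (X Y : set T) :
  countable X -> countable Y -> countable (X `|` Y).
Proof.
move=> Xc Yc; rewrite -bigcup2E; apply: bigcup_countable => // i _.
by rewrite /bigcup2; case: ifP => // _; case: ifP.
Qed.

(** The union of the countable stages is stable because two elements lie in a common stage. Unary
    operations are covered as functions ignoring their second argument. *)
Lemma countable_closure_ops (T : Type) (J : set (T -> T -> T)) (S0 : set T) :
  countable J -> countable S0 ->
  exists S, [/\ countable S, S0 `<=` S &
    forall f x y, J f -> S x -> S y -> S (f x y)].
Proof.
move=> Jc S0c.
pose F := fix F n : set T := if n is m.+1 then
  F m `|` (fun p => p.1 p.2.1 p.2.2) @` (J `*` (F m `*` F m)) else S0.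
have Fc n : countable (F n).
  elim: n => [//|n IH] /=; apply: countable_setU => //.
  apply: sub_countable (card_image_le _ _) _; by do !apply: countableX.
have F_le m n : (m <= n)%N -> F m `<=` F n.
  elim: n => [|n IH]; first by rewrite leqn0 => /eqP->.
  by rewrite leq_eqVlt => /predU1P[->//|/IH mn] x /mn Fx; left.
exists (\bigcup_n F n); split.
- exact: bigcup_countable.
- by move=> x S0x; exists 0%N.
move=> f x y Jf [m _ Fx] [n _ Fy]; exists (maxn m n).+1 => //; right.
exists (f, (x, y)) => //=; split => //; split.
- by apply: F_le Fx; exact: leq_maxl.
- by apply: F_le Fy; exact: leq_maxr.
Qed.

(** Used to recover all complex scalars on the closure of a countable set stable under Gaussian
    rationals only. *)
Lemma rat_complex_dense (R : realType) (c : R[i]) (e : R) : 0 < e ->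
  exists p : rat * rat, nrm (c - ((ratr p.1)%:C + 'i * (ratr p.2)%:C)) < e.
Proof.
move=> e0; have e2 : 0 < e / 2 by rewrite divr_gt0.
have appr (x : R) : exists q : rat, nrm ((x - ratr q)%:C : R[i]) < e / 2.
  have : x - e / 2 < x + e / 2 by lra.
  move=> /rat_in_itvoo[q]; rewrite in_itv /= => /andP[h1 h2].
  by exists q; rewrite nrm_real ltr_norml; lra.
have [p hp] := appr (complex.Re c); have [q hq] := appr (complex.Im c).
exists (p, q) => /=.
have -> : c - ((ratr p)%:C + 'i * (ratr q)%:C) =
    (complex.Re c - ratr p)%:C + 'i * (complex.Im c - ratr q)%:C.
  by rewrite [in LHS](complexE c) opprD addrACA -mulrBr -!rmorphB.
apply: le_lt_trans (nrmD _ _) _; rewrite nrmM nrmi mul1r; lra.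
Qed.

Section InvariantSubalgebra.
Variables (R : realType) (A : cstarAlgType R).

Lemma closure_amul (S : set A) : (forall x y, S x -> S y -> S (x ** y)) ->
  forall x y, closure S x -> closure S y -> closure S (x ** y).
Proof.
move=> SM x y /closure_nrmP Sx /closure_nrmP Sy; apply/closure_nrmP => e e0.
pose K := nrm x + nrm y + 1.
have K0 : 0 < K by rewrite ltr_wpDl ?addr_ge0 ?nrm_ge0.
(* The bound 1 keeps [y'] within 1 of [y]; the bound [e / K] controls the sum of both error
   terms. *)
pose r := Num.min 1 (e / K).
have r0 : 0 < r by rewrite lt_min ltr01 divr_gt0.
have [x' Sx' xx'] := Sx _ r0; have [y' Sy' yy'] := Sy _ r0.
exists (x' ** y'); first exact: SM.
have -> : x ** y - x' ** y' = x ** (y - y') + (x - x') ** y'.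
  by rewrite amulBr amulBl addrA subrK.
have rK : r * K <= e by rewrite -ler_pdivlMr// /r ge_min lexx orbT.
have r1 : r <= 1 by rewrite /r ge_min lexx.
have h1 := nrmD (x ** (y - y')) ((x - x') ** y').
have h2 := nrm_amul x (y - y'); have h3 := nrm_amul (x - x') y'.
have h4 : nrm x * nrm (y - y') <= nrm x * r by rewrite ler_wpM2l ?nrm_ge0 ?ltW.
have y'1 : nrm y' <= nrm y + r.
  have := nrmD y (- (y - y')); rewrite subKr nrmN; lra.
have h5 : nrm (x - x') * nrm y' <= nrm (x - x') * (nrm y + 1).
  by rewrite ler_wpM2l ?nrm_ge0//; lra.
have h6 : nrm (x - x') * (nrm y + 1) < r * (nrm y + 1).
  by rewrite ltr_pM2r// ltr_wpDl ?nrm_ge0.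
rewrite /K mulrDr mulrDr in rK; lra.
Qed.

Lemma closure_nonexpansive (S : set A) (f : A -> A) :
  (forall x y, nrm (f x - f y) <= nrm (x - y)) -> (forall x, S x -> S (f x)) ->
  forall x, closure S x -> closure S (f x).
Proof.
move=> fn fS x /closure_nrmP Sx; apply/closure_nrmP => e /Sx[y Sy xy].
by exists (f y); [exact: fS|exact: le_lt_trans xy].
Qed.

Lemma closure_add (S : set A) : (forall x y, S x -> S y -> S (x + y)) ->
  forall x y, closure S x -> closure S y -> closure S (x + y).
Proof.
move=> SD x y /closure_nrmP Sx /closure_nrmP Sy; apply/closure_nrmP => e e0.
have e2 : 0 < e / 2 by rewrite divr_gt0.
have [x' Sx' xx'] := Sx _ e2; have [y' Sy' yy'] := Sy _ e2.
exists (x' + y'); first exact: SD.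
by rewrite opprD addrACA (le_lt_trans (nrmD _ _))// [e]splitr ltrD.
Qed.

Lemma closure_scale (S : set A) :
  (forall p : rat * rat, forall x, S x ->
     S (((ratr p.1)%:C + 'i * (ratr p.2)%:C) *: x)) ->
  forall c x, closure S x -> closure S (c *: x).
Proof.
move=> SZ c x /closure_nrmP Sx; apply/closure_nrmP => e e0.
have e2 : 0 < e / 2 by rewrite divr_gt0.
have K0 : 0 < nrm c + 1 by rewrite ltr_wpDl ?nrm_ge0.
have [y Sy xy] := Sx _ (divr_gt0 e2 K0).
have y0 : 0 < nrm y + 1 by rewrite ltr_wpDl ?nrm_ge0.
have [p cp] := rat_complex_dense c (divr_gt0 e2 y0).
exists (((ratr p.1)%:C + 'i * (ratr p.2)%:C) *: y); first exact: SZ.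
set q := (ratr p.1)%:C + _ in cp *.
have -> : c *: x - q *: y = c *: (x - y) + (c - q) *: y.
  by rewrite scalerBr scalerBl addrA subrK.
apply: le_lt_trans (nrmD _ _) _; rewrite !nrmZ [e]splitr.
rewrite (ltr_pdivlMr _ _ K0) in xy; rewrite (ltr_pdivlMr _ _ y0) in cp.
apply: ltr_leD; last first.
  by apply: le_trans (ltW cp); rewrite ler_wpM2l ?nrm_ge0 ?lerDl.
by apply: le_lt_trans xy; rewrite mulrC ler_wpM2l ?nrm_ge0 ?lerDl.
Qed.

(** [E] is the closure of a countable set stable under the operations in [J]; countability of [G]
    makes [J] countable, and continuity carries stability to the closure. *)
Lemma invariant_separable_subalg (G : groupType) (alpha : cstar_action G A)
    (D : cstar_subalg A) :
  countable [set: G] -> separable_subset (D : set A) ->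
  exists E : cstar_subalg A, [/\ D `<=` E, act_invariant alpha E &
    separable_subset (E : set A)].
Proof.
move=> Gc [S0 [S0c S0D DS0]].
pose J : set (A -> A -> A) :=
  [set +%R] `|` ([set (fun x y => x ** y)] `|` ([set (fun x _ => star x)] `|`
  (range (fun (p : rat * rat) x (_ : A) =>
     ((ratr p.1)%:C + 'i * (ratr p.2)%:C : R[i]) *: x) `|`
   range (fun g x (_ : A) => alpha g x)))).
have Jc : countable J.
  by do !apply: countable_setU => //; apply: sub_countable (card_image_le _ _) _.
have [S [Sc S0S SJ]] := countable_closure_ops Jc S0c.
have SD x y : S x -> S y -> S (x + y) by move=> *; apply: SJ => //; left.
have SM x y : S x -> S y -> S (x ** y).
  by move=> Sx Sy; apply: (SJ (fun x y => x ** y)) => //; right; left.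
have Sst x : S x -> S (star x).
  by move=> Sx; apply: (SJ (fun x _ => star x) _ x) => //; right; right; left.
have SZ (p : rat * rat) x : S x -> S (((ratr p.1)%:C + 'i * (ratr p.2)%:C) *: x).
  move=> Sx; apply: (SJ (fun x _ => _ *: x) _ x) => //.
  by right; right; right; left; exists p.
have Sact g x : S x -> S (alpha g x).
  move=> Sx; apply: (SJ (fun x _ => alpha g x) _ x) => //.
  by right; right; right; right; exists g.
have DS : D `<=` closure S by move=> x /DS0; exact: closure_subset.
have cst : forall x, closure S x -> closure S (star x).
  by apply: closure_nonexpansive => // x y; rewrite -starB nrm_star.
pose E0 := StarSubalg (DS _ (ssa0 D)) (closure_add SD) (closure_scale SZ)
  (closure_amul SM) cst.
have E0c : closed (E0 : set A) by exact: closed_closure.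
exists (CstarSubalg E0c); split => //.
- move=> g; apply: closure_nonexpansive (Sact g) => x y.
  have -> : alpha g x - alpha g y = alpha g (x - y).
    by have := act_linear alpha g (-1) y x; rewrite !scaleN1r ![- _ + _]addrC.
  by apply: star_hom_contractive;
    [exact: act_linear|exact: act_amul|exact: act_star].
- by exists S; split => //; exact: subset_closure.
Qed.

End InvariantSubalgebra.

(** * The homomorphism [F(E, A) -> F(D, A)] for [D] inside [E] *)

Section CentralRestriction.
Variables (R : realType) (A : cstarAlgType R) (D E : cstar_subalg A).
Hypothesis DE : D `<=` E.

Fact commutant_sub_subproof (x : ssa_type (commutant E)) :
  ssa_set (commutant D) (ssa_val x).
Proof. by move=> d /DE; exact: (ssa_valP x). Qed.
Definition commutant_sub x : ssa_type (commutant D) :=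
  to_ssa (commutant_sub_subproof x).

Definition central_restr (x : central_alg E) : central_alg D :=
  quot_pi (annihilator D) (commutant_sub (quot_repr x)).

(** What annihilates [E] annihilates [D], so the choice of representative does not matter. *)
Lemma central_restrE x :
  central_restr (quot_pi (annihilator E) x) =
  quot_pi (annihilator D) (commutant_sub x).
Proof.
by apply/quot_piP => d /DE; exact: (@quot_reprP _ _ (annihilator E) x).
Qed.

Lemma central_restr_linear : linear central_restr.
Proof.
move=> c x y; rewrite -[x]quot_reprK -[y]quot_reprK -quot_piZ -quot_piD.
by rewrite !central_restrE -quot_piZ -quot_piD; congr quot_pi; exact: ssa_ext.
Qed.

Lemma central_restrM : {morph central_restr : x y / x ** y}.
Proof.
move=> x y; rewrite -[x]quot_reprK -[y]quot_reprK -quot_piM.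
by rewrite !central_restrE -quot_piM; congr quot_pi; exact: ssa_ext.
Qed.

Lemma central_restr_star : {morph central_restr : x / star x}.
Proof.
move=> x; rewrite -[x]quot_reprK -quot_pi_star.
by rewrite !central_restrE -quot_pi_star; congr quot_pi; exact: ssa_ext.
Qed.

(** Every representative of [x] also represents its image, so the infimum defining the norm can only
    decrease. *)
Lemma central_restr_contractive x : nrm (central_restr x) <= nrm x.
Proof.
rewrite (quot_nrmE x); apply/ler_addgt0Pr => e e0.
have [y <- ye] := quot_nrm_adh x e0.
rewrite central_restrE; apply: le_trans (quot_nrm_le _ _) _.
exact: ltW ye.
Qed.

Lemma central_restr_act (G : groupType) (H : groupClosed G)
    (alpha : cstar_action G A) (Einv : act_invariant alpha E)
    (Dinv : act_invariant (restrict_action alpha H) D) (h : subgroup_type H) x :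
  central_restr (central_act Einv (sg_val h) x) =
  central_act Dinv h (central_restr x).
Proof.
rewrite -[x]quot_reprK central_actE !central_restrE central_actE.
congr quot_pi; apply: ssa_ext; rewrite /= /seq_act.
by congr quot_pi; exact: linfty_ext.
Qed.

(* A central sequence [w] with [w d = d w = d] on [E] shows that any
   representative [u] of the identity of [F(E, A)] satisfies [u d = u w d =
   w d = d], and so acts as the identity on the larger commutant of [D]. *)
Lemma central_restr_identity (u : central_alg E) :
  separable_subset (E : set A) -> is_identity u ->
  is_identity (central_restr u).
Proof.
move=> /separable_approximate_right_unit[v vE] uid.
have vE' d : ssa_set E d -> star v ** seq_embed d = seq_embed d.
  move=> Ed; rewrite -[seq_embed d]starK -starM -seq_embed_star vE//.
  exact: ssa_star.
(* The quasi-product of [v] and [star v] is a two-sided unit on [E], hence commutes with [E]. *)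
pose w := v + star v - v ** star v.
have dw d : ssa_set E d -> seq_embed d ** w = seq_embed d.
  by move=> Ed; rewrite /w amulBr amulDr amulA vE// addrK.
have wd d : ssa_set E d -> w ** seq_embed d = seq_embed d.
  by move=> Ed; rewrite /w amulBl amulDl -amulA vE'// [_ + seq_embed d]addrC addrK.
have wcomm : ssa_set (commutant E) w by move=> d Ed; rewrite dw// wd.
rewrite -[u]quot_reprK in uid *; move: (quot_repr u) uid => {}u uid.
have ud d : ssa_set D d -> ssa_val u ** seq_embed d = seq_embed d.
  move=> /DE Ed; have [+ _] := uid (quot_pi _ (to_ssa wcomm)).
  rewrite -quot_piM => /quot_piP/(_ d Ed)[+ _].
  by rewrite /= amulBl -amulA wd// => /eqP; rewrite subr_eq0 => /eqP.
have du d : ssa_set D d -> seq_embed d ** ssa_val u = seq_embed d.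
  by move=> Dd; rewrite -[RHS]ud//; apply/esym/(ssa_valP u)/DE.
rewrite central_restrE => x; rewrite -[x]quot_reprK -!quot_piM.
move: (quot_repr x) => {}x.
have xD : commutant_set D (ssa_val x) := ssa_valP x.
split; apply/quot_piP => d Dd; have xd := xD d Dd; split; rewrite /=.
- by rewrite amulBl -amulA xd amulA ud// subrr.
- by rewrite amulBr amulA du// subrr.
- by rewrite amulBl -amulA ud// subrr.
- by rewrite amulBr amulA -xd -amulA du// subrr.
Qed.

End CentralRestriction.

(** * Completely positive order zero maps and pullbacks of functions *)

Lemma linear_addr (K : nzRingType) (U V : lmodType K) (f : U -> V) :
  linear f -> {morph f : x y / x + y}.
Proof. by move=> fL x y; have := fL 1 x y; rewrite !scale1r. Qed.

Lemma linear_zero (K : nzRingType) (U V : lmodType K) (f : U -> V) :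
  linear f -> f 0 = 0.
Proof. by move=> /linear_addr fD; apply: (addrI (f 0)); rewrite -fD !addr0. Qed.

Lemma star_hom_completely_positive (R : realType) (B C : nstarAlgType R)
    (f : B -> C) : linear f -> {morph f : x y / x ** y} ->
  {morph f : x / star x} -> completely_positive f.
Proof.
move=> fL fM fs n x [y ->]; exists (map_mx f y); apply/matrixP => i j.
rewrite !mxE (big_morph f (linear_addr fL) (linear_zero fL)); apply: eq_bigr => k _.
by rewrite !mxE fM fs.
Qed.

Lemma completely_positive_comp (R : realType) (B C E : nstarAlgType R)
    (f : C -> E) (g : B -> C) :
  completely_positive f -> completely_positive g -> completely_positive (f \o g).
Proof. by move=> fP gP n x /gP/fP; rewrite -map_mx_comp. Qed.

Lemma ccp_comp (R : realType) (B C E : nstarAlgType R) (f : C -> E) (g : B -> C) :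
  ccp f -> ccp g -> ccp (f \o g).
Proof.
move=> [fL fP fn] [gL gP gn]; split.
- by move=> c x y; rewrite /= gL fL.
- exact: completely_positive_comp.
- by move=> x; apply: le_trans (fn _) (gn x).
Qed.

Lemma star_hom_order_zero (R : realType) (B C : nstarAlgType R)
    (f : B -> C) : linear f -> {morph f : x y / x ** y} ->
  {morph f : x / star x} -> order_zero f.
Proof.
move=> fL fM fs a b [ab ba ab' ba'].
have f0 := linear_zero fL.
by split; rewrite -?fs -fM ?ab ?ba ?ab' ?ba'.
Qed.

Section Pullback.
Variables (R : realType) (S T : Type) (B : nstarAlgType R) (f : S -> T).

Fact pullback_subproof (x : linfty T B) : nbounded (fun s => x (f s)).
Proof. by apply/asboolP; exists (linfty_nrm x) => s; exact: nrm_le_linfty. Qed.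
Definition pullback x : linfty S B := Linfty (pullback_subproof x).

Lemma pullback_linear : linear pullback.
Proof. by move=> c x y; exact: linfty_ext. Qed.

Lemma pullbackM : {morph pullback : x y / x ** y}.
Proof. by move=> x y; exact: linfty_ext. Qed.

Lemma pullback_star : {morph pullback : x / star x}.
Proof. by move=> x; exact: linfty_ext. Qed.

Lemma pullback_contractive x : nrm (pullback x) <= nrm x.
Proof.
apply: linfty_nrm_le => [|s]; first exact: linfty_nrm_ge0.
exact: (nrm_le_linfty x (f s)).
Qed.

End Pullback.

Lemma star_hom_ccp (R : realType) (B C : nstarAlgType R) (f : B -> C) :
  linear f -> {morph f : x y / x ** y} -> {morph f : x / star x} ->
  (forall x, nrm (f x) <= nrm x) -> ccp f.
Proof.
move=> fL fM fs fn; split => //; first exact: star_hom_completely_positive.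
by move=> x; rewrite !nrmE lecR.
Qed.

(** * Transport of Rokhlin towers *)

Section RestrictedTowers.
Variables (R : realType) (G : groupType) (H : groupClosed G).
Variables (A : cstarAlgType R) (alpha : cstar_action G A).
Variables (M : groupClosed (subgroup_type H)) (N : groupClosed G).
Variable f : coset_space N -> coset_space M.
Hypothesis f_act : forall (h : subgroup_type H) c,
  f (coset_act (sg_val h) c) = coset_act h (f c).
Variables D E : cstar_subalg A.
Hypotheses (DE : D `<=` E) (Esep : separable_subset (E : set A)).

Definition restrict_tower d (phi : 'I_d -> coset_alg R N -> central_alg E) :
    'I_d -> coset_alg R M -> central_alg D :=
  fun l => central_restr DE \o (phi l \o pullback f).

Lemma restrict_tower_rokhlin (Dinv : act_invariant (restrict_action alpha H) D)
    (Einv : act_invariant alpha E) d (phi : 'I_d.+1 -> _) :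
  @rokhlin_towers R G A alpha N E Einv d phi ->
  @rokhlin_towers R _ A (restrict_action alpha H) M D Dinv d
    (restrict_tower phi).
Proof.
have rL := central_restr_linear DE; have rM := central_restrM DE.
have rs := central_restr_star DE; have rn := central_restr_contractive DE.
have pL := @pullback_linear R _ _ R[i]^o f; have pM := @pullbackM R _ _ R[i]^o f.
have ps := @pullback_star R _ _ R[i]^o f.
have pn := @pullback_contractive R _ _ R[i]^o f.
move=> [phic phi0 phia phi1]; split.
- move=> l; apply: ccp_comp; first exact: star_hom_ccp.
  by apply: ccp_comp (phic l) _; exact: star_hom_ccp.
- move=> l a b ab; apply: (star_hom_order_zero rL rM rs); apply: (phi0 l).
  exact: (star_hom_order_zero pL pM ps).
- move=> l h a; rewrite /restrict_tower /= -(central_restr_act DE Einv) -phia.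
  congr (central_restr _ (phi l _)); apply: linfty_ext => c /=.
  (* Equivariance of [f] is used at [h^-1], since shifts act through inverses. *)
  by congr (a _); rewrite -f_act.
(* Constants pull back to constants, so the new towers at the unit sum to the image of the old
   sum. *)
- have <- : central_restr DE (\sum_l phi l (coset_one R N)) =
      \sum_l restrict_tower phi l (coset_one R M).
    rewrite (big_morph _ (linear_addr rL) (linear_zero rL)); apply: eq_bigr => l _.
    by congr (central_restr _ (phi l _)); exact: linfty_ext.
  exact: central_restr_identity.
Qed.

Lemma restrict_tower_commuting d (phi : 'I_d -> coset_alg R N -> central_alg E) :
  commuting_ranges phi -> commuting_ranges (restrict_tower phi).
Proof.
by move=> phiC k l kl a b; rewrite /restrict_tower /= -!central_restrM phiC.
Qed.

End RestrictedTowers.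

Theorem theorem3p7 (R : realType) (G : groupType) (H : groupClosed G)
    (A : cstarAlgType R) (alpha : cstar_action G A) :
  countable [set: G] ->
  residually_finite G ->
  virtual_retract H ->
  (rokhlin_dim (restrict_action alpha H) <= rokhlin_dim alpha)%E /\
  (rokhlin_dim_comm (restrict_action alpha H) <= rokhlin_dim_comm alpha)%E.
Proof.
move=> Gc _ HG; split; apply: ge_ereal_sup => _ [M [Mfin ->]];
    have [N [Nfin [f f_act]]] := virtual_retract_coset_map HG Mfin.
(* Each [d] admissible for [N] is admissible for [M]; this inclusion orders the infima, also when
   none is admissible for [N] and its infimum is infinite. *)
- apply: (@le_trans _ _ (rokhlin_dim_at alpha N)); last first.
    by apply: ereal_sup_ubound; exists N.
  apply: le_ereal_inf; apply: image_subset => d hd D Dinv Dsep.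
  have [E [DE Einv Esep]] := invariant_separable_subalg alpha Gc Dsep.
  have [phi phiP] := hd E Einv Esep.
  by exists (restrict_tower f DE phi); exact: restrict_tower_rokhlin phiP.
- apply: (@le_trans _ _ (rokhlin_dim_comm_at alpha N)); last first.
    by apply: ereal_sup_ubound; exists N.
  apply: le_ereal_inf; apply: image_subset => d hd D Dinv Dsep.
  have [E [DE Einv Esep]] := invariant_separable_subalg alpha Gc Dsep.
  have [phi [phiP phiC]] := hd E Einv Esep.
  exists (restrict_tower f DE phi); split; first exact: restrict_tower_rokhlin phiP.
  exact: restrict_tower_commuting.
Qed.
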